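(* (i) The space $\mathcal{H}$ is the orbit closure of $\widetilde{0}$ in the dynamical system $(H(\mathbb{T})^{\mathbb{Z}_+},T)$ or, equivalently, $\mathcal{H}=\overline{\{\widetilde{n}:n\in\mathbb{N}\}}$. (ii) The function $\rho_m:\mathcal{H}\to\mathcal{H}_m$ is surjective for every $m\in\mathbb{N}$. (iii) For any $m\in\mathbb{N}$, $(\phi_k)_{k=0}^m\in\mathcal{H}_m$ and $x_0\in\mathbb{T}\setminus\mathbb{T}_Q$, we have $$\{\phi_{m+1}(x_0)\ :\ \phi_{m+1}\in H(\mathbb{T}),\ (\phi_k)_{k=0}^{m+1}\in\mathcal{H}_{m+1}\}=\mathbb{T}.$$
   Context: $\mathbb{N}=\{1,2,\ldots\}$, $\mathbb{Z}_+=\{0,1,2,\ldots\}$; $\mathbb{T}$ is the unit circle in $\mathbb{C}$, a group under multiplication; $\mathbb{T}_Q=\{e^{i2\pi q}:q\in\mathbb{Q}\}$. $H(\mathbb{T})$ is the set of all (not necessarily continuous) group homomorphisms $\mathbb{T}\to\mathbb{T}$; with pointwise multiplication and the topology of pointwise convergence it is a compact abelian group. For $n\in\mathbb{Z}$, $n^\times\in H(\mathbb{T})$ is $x\mapsto x^n$. $\phi^{(j)}$ denotes the $j$-fold composition of $\phi$ with itself. The integers $s(k,j)$ are the (signed) Stirling numbers of the first kind: $n(n-1)\cdots(n-k+1)=\sum_{j=0}^k s(k,j)n^j$. $\mathcal{H}$ is the set of all $(\phi_k)_{k=0}^\infty\in H(\mathbb{T})^{\mathbb{Z}_+}$ with $\phi_0=1^\times=\mathrm{id}_{\mathbb{T}}$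 and $\phi_k(x^{k!})=\prod_{j=1}^k\phi_1^{(j)}(x^{s(k,j)})$ for all $x\in\mathbb{T}_Q$, $k\in\mathbb{N}$. For $m\in\mathbb{N}$, $\mathcal{H}_m$ is the set of all $(\phi_k)_{k=0}^m\in H(\mathbb{T})^{\{0,\ldots,m\}}$ satisfying the same conditions for $1\le k\le m$ (and $\phi_0=1^\times$). Both have the subspace topology of the product. $\rho_m:\mathcal{H}\to\mathcal{H}_m$ is $(\phi_k)_{k=0}^\infty\mapsto(\phi_k)_{k=0}^m$. $T:H(\mathbb{T})^{\mathbb{Z}_+}\to H(\mathbb{T})^{\mathbb{Z}_+}$ is the homeomorphism $T(\phi_0,\phi_1,\phi_2,\ldots)=(\phi_0,\phi_0\phi_1,\phi_1\phi_2,\ldots)$ (pointwise products). $\widetilde{0}=(1^\times,0^\times,0^\times,\ldots)$ and $\widetilde{n}=T^n\widetilde{0}$ for $n\in\mathbb{Z}$. The orbit closure of a point $x$ in a system $(X,s)$ is $\overline{\{s^nx:n\in\mathbb{Z}\}}$. *)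

(* Defs.v *)
From HB Require Import structures.
From mathcomp Require Import all_boot all_order all_algebra.
From mathcomp Require Import all_classical all_reals all_analysis.
From mathcomp Require Import complex.

Set Implicit Arguments.
Unset Strict Implicit.
Unset Printing Implicit Defensive.

Import Order.TTheory GRing.Theory Num.Theory.
Import numFieldNormedType.Exports.

Local Open Scope classical_set_scope.
Local Open Scope ring_scope.
Local Open Scope complex_scope.

Record circle (R : realType) := Circle {
  cval :> R[i];
  cval_norm : `|cval| == 1 }.

Section Circle.
Variable R : realType.
Local Notation T := (circle R).

HB.instance Definition _ := [isSub for @cval R].
HB.instance Definition _ := [Choice of T by <:].
(* R[i] carries the topology of its norm under the alias R[i]^o. *)
HB.instance Definition _ := Topological.copy T
  (initial_topology (fun x : T => (x : R[i]^o))).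

Lemma circle_one_subproof : `|1 : R[i]| == 1.
Proof. by rewrite normr1. Qed.

Lemma circle_mul_subproof (x y : T) : `|(x : R[i]) * y| == 1.
Proof. by rewrite normrM (eqP (cval_norm x)) mul1r (cval_norm y). Qed.

Lemma circle_inv_subproof (x : T) : `|(x : R[i])^-1| == 1.
Proof. by rewrite normfV (eqP (cval_norm x)) invr1. Qed.

Definition circle_one : T := Circle circle_one_subproof.
Definition circle_mul (x y : T) : T := Circle (circle_mul_subproof x y).
Definition circle_inv (x : T) : T := Circle (circle_inv_subproof x).

Lemma circle_mulA : associative circle_mul.
Proof. by move=> x y z; apply: val_inj; rewrite /= mulrA. Qed.

Lemma circle_mulC : commutative circle_mul.
Proof. by move=> x y; apply: val_inj; rewrite /= mulrC. Qed.

Lemma circle_mul1 : left_id circle_one circle_mul.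
Proof. by move=> x; apply: val_inj; rewrite /= mul1r. Qed.

Lemma circle_mulr1 : right_id circle_one circle_mul.
Proof. by move=> x; rewrite circle_mulC circle_mul1. Qed.

Lemma circle_mulV : left_inverse circle_one circle_inv circle_mul.
Proof.
move=> x; apply: val_inj => /=; rewrite mulVf //.
by rewrite -normr_eq0 (eqP (cval_norm x)) oner_eq0.
Qed.

Lemma circle_mulrV : right_inverse circle_one circle_inv circle_mul.
Proof. by move=> x; rewrite circle_mulC circle_mulV. Qed.

HB.instance Definition _ := isGroup.Build T
  circle_mulA circle_mul1 circle_mulr1 circle_mulV circle_mulrV.

Lemma circle_commute (x y : T) : commute x y.
Proof. exact: circle_mulC. Qed.

Lemma expi_subproof (t : R) : `|cos t +i* sin t| == 1.
Proof.
by rewrite normc_def /= cos2Dsin2 sqrtr1.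
Qed.

Definition expi (t : R) : T := Circle (expi_subproof t).

End Circle.

Definition TQ (R : realType) : set (circle R) :=
  range (fun q : rat => expi (2 * pi * ratr q)).

Definition expgz (G : groupType) (x : G) (n : int) : G :=
  match n with
  | Posz k => (x ^+ k)%g
  | Negz k => (x ^- k.+1)%g
  end.

(* Not necessarily continuous group homomorphisms, with the topology of
   pointwise convergence. *)
Definition homT (R : realType) := {multiplicative circle R -> circle R}.

Section HomT.
Variable R : realType.
Local Notation T := (circle R).

Lemma homT_ext (f g : homT R) : f =1 g -> f = g.
Proof.
case: f g => [f [[fM]]] [g [[gM]]] /= fg.
have efg : f = g by apply/funext.
by move: gM; rewrite -efg => gM; rewrite (Prop_irrelevance fM gM).
Qed.

HB.instance Definition _ := gen_eqMixin (homT R).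
HB.instance Definition _ := gen_choiceMixin (homT R).
HB.instance Definition _ := Topological.copy (homT R)
  (initial_topology (fun f : homT R => (f : {ptws T -> T}))).

Lemma homT_one_subproof : {morph (fun _ : T => 1%g : T) : x y / (x * y)%g}.
Proof. by move=> x y; rewrite mulg1. Qed.

Lemma homT_mul_subproof (f g : homT R) :
  {morph (fun x => (f x * g x)%g) : x y / (x * y)%g}.
Proof.
move=> x y; rewrite !gmulfM -!mulgA; congr (_ * _)%g.
by rewrite !mulgA; congr (_ * _)%g; exact: circle_commute.
Qed.

Lemma homT_inv_subproof (f : homT R) :
  {morph (fun x => (f x)^-1%g) : x y / (x * y)%g}.
Proof. by move=> x y; rewrite gmulfM invgM; exact: circle_commute. Qed.

Lemma homT_pow_subproof (n : int) :
  {morph (fun x : T => expgz x n) : x y / (x * y)%g}.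
Proof.
move=> x y; case: n => k /=; rewrite expgMn; try exact: circle_commute.
  by [].
by rewrite invgM; exact: circle_commute.
Qed.

Definition homT_of (f : T -> T) (fM : {morph f : x y / (x * y)%g}) : homT R :=
  HB.pack f (isMultiplicative.Build T T f fM).

Definition homT_one : homT R := homT_of homT_one_subproof.
Definition homT_mul (f g : homT R) : homT R := homT_of (homT_mul_subproof f g).
Definition homT_inv (f : homT R) : homT R := homT_of (homT_inv_subproof f).

Lemma homT_mulA : associative homT_mul.
Proof. by move=> f g h; apply: homT_ext => x /=; rewrite mulgA. Qed.

Lemma homT_mulC : commutative homT_mul.
Proof. by move=> f g; apply: homT_ext => x; exact: circle_commute. Qed.

Lemma homT_mul1 : left_id homT_one homT_mul.
Proof. by move=> f; apply: homT_ext => x /=; rewrite mul1g. Qed.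

Lemma homT_mulr1 : right_id homT_one homT_mul.
Proof. by move=> f; rewrite homT_mulC homT_mul1. Qed.

Lemma homT_mulV : left_inverse homT_one homT_inv homT_mul.
Proof. by move=> f; apply: homT_ext => x /=; rewrite mulVg. Qed.

Lemma homT_mulrV : right_inverse homT_one homT_inv homT_mul.
Proof. by move=> f; rewrite homT_mulC homT_mulV. Qed.

HB.instance Definition _ := isGroup.Build (homT R)
  homT_mulA homT_mul1 homT_mulr1 homT_mulV homT_mulrV.

Definition powT (n : int) : homT R := homT_of (homT_pow_subproof n).

Lemma powT1 (x : T) : powT 1 x = x.
Proof. by []. Qed.

End HomT.

Arguments powT : clear implicits.

(* Signed Stirling numbers of the first kind, as the coefficients of the
   falling factorial X (X - 1) ... (X - k + 1). *)
Definition stirling1 (k j : nat) : int :=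
  (\prod_(i < k) ('X - (i%:Z)%:P))`_j.

Definition stirling_rel (R : realType) (phi1 : homT R) (k : nat)
    (phik : homT R) : Prop :=
  forall x : circle R, TQ x ->
    phik (x ^+ k`!)%g =
      (\prod_(1 <= j < k.+1) iter j phi1 (expgz x (stirling1 k j)))%g.

Definition calH (R : realType) : set {ptws nat -> homT R} :=
  [set phi | phi 0%N = powT R 1 /\
    forall k, (0 < k)%N -> stirling_rel (phi 1%N) k (phi k)].

(* For 0 < m, inord 1 is the index 1 of the tuple (phi_0, ..., phi_m);
   the definition is only meant for such m. *)
Definition calHm (R : realType) (m : nat) : set {ptws 'I_m.+1 -> homT R} :=
  [set phi | phi ord0 = powT R 1 /\
    forall k : 'I_m.+1, (0 < k)%N -> stirling_rel (phi (inord 1)) k (phi k)].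

Definition rho (R : realType) (m : nat) (phi : {ptws nat -> homT R}) :
  {ptws 'I_m.+1 -> homT R} := fun k => phi k.

Lemma rho_calH (R : realType) (m : nat) :
  (0 < m)%N -> set_fun (@calH R) (@calHm R m) (@rho R m).
Proof.
move=> m0 phi [phi0 phiP]; split=> //= k k0.
by rewrite /rho inordK ?ltnS //; exact: phiP.
Qed.

Definition extend (R : realType) (m : nat) (phi : {ptws 'I_m.+1 -> homT R})
    (psi : homT R) : {ptws 'I_m.+2 -> homT R} :=
  fun k => if unlift ord_max k is Some j then phi j else psi.

Section Shift.
Variable R : realType.
Implicit Types phi : {ptws nat -> homT R}.

Definition Tshift phi : {ptws nat -> homT R} :=
  fun k => if k is k'.+1 then (phi k' * phi k)%g else phi 0%N.

(* Solving psi = Tshift phi gives phi_0 = psi_0, phi_k = phi_(k-1)^-1 psi_k. *)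
Fixpoint Tshift_inv phi (k : nat) : homT R :=
  if k is k'.+1 then ((Tshift_inv phi k')^-1 * phi k)%g else phi 0%N.

Lemma TshiftK : cancel Tshift (Tshift_inv : _ -> {ptws nat -> homT R}).
Proof.
by move=> phi; apply/funext; elim=> [//|k IH] /=; rewrite IH mulKg.
Qed.

Lemma Tshift_invK : cancel (Tshift_inv : _ -> {ptws nat -> homT R}) Tshift.
Proof.
by move=> phi; apply/funext => -[|k] //=; rewrite mulVKg.
Qed.

End Shift.

(* Integer iterates of a bijection f with inverse g. *)
Definition iterz (X : Type) (f g : X -> X) (n : int) : X -> X :=
  match n with
  | Posz k => iter k f
  | Negz k => iter k.+1 g
  end.

Definition orbit_closure (X : topologicalType) (f g : X -> X) (x : X) : set X :=
  closure (range (fun n : int => iterz f g n x)).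

Definition tilde0 (R : realType) : {ptws nat -> homT R} :=
  fun k => if k is 0%N then powT R 1 else powT R 0.

Definition tilde (R : realType) (n : int) : {ptws nat -> homT R} :=
  iterz (@Tshift R) (@Tshift_inv R) n (tilde0 R).

(* Main.v *)
Require Import Defs.
From mathcomp Require Import all_boot all_order all_algebra.
From mathcomp Require Import all_classical all_reals all_analysis.
From mathcomp Require Import complex ring lra zify.

(* The n-th point of the orbit has coordinates x |-> x^C(n, k), and on the roots
   of unity of a fixed order every point of H looks like such a point: phi_1 is
   there a power map x |-> x^n, and the Stirling relation then forces
   phi_k x = x^C(n, k), for all n in some arithmetic progression.  Hence H is
   closed and contains the orbit.  Conversely, let finitely many values
   phi_k(x_j) be given.  Weyl's criterion is applied along this progression to
   the sequences x_j^C(n, k) / phi_k(x_j): a monomial in them is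
   prod_k X_k^C(n, k) / phi_k(X_k) with X_k a monomial in the x_j.  It is
   constantly 1 if all X_k have finite order (dividing the order fixed at the
   start), and otherwise it is a polynomial sequence whose leading coefficient
   has infinite order, so that its averages tend to 0 by van der Corput's
   inequality.  Working with monomials of bounded exponents only, one never needs
   a basis of the group generated by the x_j.
   For (ii) and (iii), the Stirling relation prescribes a homomorphism on the
   torsion subgroup, its value at a point of infinite order is free, and the
   divisibility of the circle extends it by Zorn's lemma. *)

Set Implicit Arguments.
Unset Strict Implicit.
Unset Printing Implicit Defensive.

Import Order.TTheory GRing.Theory Num.Theory.
Import numFieldNormedType.Exports.

Local Open Scope classical_set_scope.
Local Open Scope ring_scope.

(* Division-free form of (1/N) \sum_(n < N) g n --> 0. *)
Definition mean0 (C : numClosedFieldType) (g : nat -> C) :=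
  forall q : nat, exists N0 : nat, forall N : nat, (N0 <= N)%N ->
    q%:R * `|\sum_(n < N) g n| <= N%:R.

(** * Sequences of mean zero and van der Corput's inequality *)

Section MeanZero.
Variable C : numClosedFieldType.
Implicit Types g : nat -> C.

Lemma mean0_conj g : mean0 g -> mean0 (fun n => (g n)^*).
Proof.
move=> g0 q; have [N0 gN] := g0 q; exists N0 => N /gN.
by rewrite -rmorph_sum norm_conjC.
Qed.

Lemma mean0_uniform (I : finType) (P : pred I) (F : I -> nat -> C) (q : nat) :
  (forall i, P i -> mean0 (F i)) ->
  exists N0 : nat, forall N : nat, (N0 <= N)%N -> forall i, P i ->
    q%:R * `|\sum_(n < N) F i n| <= N%:R.
Proof.
move=> F0.
have /choice[N0 N0P] : forall i, exists N0 : nat, P i -> forall N : nat,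
    (N0 <= N)%N -> q%:R * `|\sum_(n < N) F i n| <= N%:R.
  move=> i; have [Pi|nPi] := boolP (P i); last by exists 0%N.
  by have [N0 ?] := F0 i Pi q; exists N0.
exists (\max_i N0 i)%N => N leN i Pi; apply: N0P => //.
by apply: leq_trans leN; exact: leq_bigmax.
Qed.

Lemma sqr_norm_sum (I : finType) (x : I -> C) :
  `|\sum_i x i| ^+ 2 = \sum_i \sum_j x i * (x j)^*.
Proof.
rewrite normCK rmorph_sum mulr_suml; apply: eq_bigr => i _.
by rewrite mulr_sumr.
Qed.

(** Cauchy-Schwarz against the constant 1: expand the nonnegative double sum of (|x_i| - |x_j|)^2,
    then apply the triangle inequality. *)
Lemma sqr_norm_sum_le (I : finType) (x : I -> C) :
  `|\sum_i x i| ^+ 2 <= #|I|%:R * \sum_i `|x i| ^+ 2.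
Proof.
have h : 0 <= \sum_i \sum_j (`|x i| - `|x j|) ^+ 2.
  apply: sumr_ge0 => i _; apply: sumr_ge0 => j _.
  by rewrite real_exprn_even_ge0 // rpredB // normr_real.
have e : \sum_i \sum_j (`|x i| - `|x j|) ^+ 2 =
    (#|I|%:R * \sum_i `|x i| ^+ 2) *+ 2 - (\sum_i `|x i|) ^+ 2 *+ 2.
  under eq_bigr do under eq_bigr do rewrite sqrrB.
  under eq_bigr do rewrite big_split /= sumrB /= sumr_const.
  rewrite big_split /= sumrB /= sumr_const.
  have -> : \sum_i \sum_j `|x i| * `|x j| *+ 2 = (\sum_i `|x i|) ^+ 2 *+ 2.
    rewrite expr2 mulr_suml -sumrMnl; apply: eq_bigr => i _.
    by rewrite mulr_sumr -sumrMnl.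
  rewrite -mulr_natl sumrMnl; ring.
move: h; rewrite e subr_ge0 lerMn2r /=; apply: le_trans.
rewrite ler_pXn2r ?nnegrE //; first exact: ler_norm_sum.
by apply: sumr_ge0.
Qed.

Lemma norm_sum_le1 g (I : finType) (k : I -> nat) :
  (forall n, `|g n| = 1) -> `|\sum_i g (k i)| <= #|I|%:R.
Proof.
move=> g1; apply: le_trans (ler_norm_sum _ _ _) _.
by under eq_bigr do rewrite g1; rewrite sumr_const.
Qed.

(** The two windows differ only in h terms at each end, each of modulus 1. *)
Lemma sum_shift_le g (N h : nat) : (forall n, `|g n| = 1) ->
  `|\sum_(n < N) g n - \sum_(n < N) g (n + h)%N| <= (h + h)%:R.
Proof.
move=> g1.
have e : \sum_(n < N) g n + \sum_(i < h) g (N + i)%N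
       = \sum_(i < h) g i + \sum_(n < N) g (n + h)%N.
  rewrite -(big_mkord xpredT g) -(big_mkord xpredT (fun i => g (N + i)%N)).
  rewrite -(big_mkord xpredT g) -(big_mkord xpredT (fun i => g (i + h)%N)).
  rewrite (_ : \sum_(0 <= i < h) g (N + i)%N = \sum_(N <= i < N + h) g i); last first.
    by rewrite -{2}[N]add0n big_addn addKn; apply: eq_bigr => i _; rewrite addnC.
  rewrite -big_cat_nat ?leq_addr //=.
  rewrite (_ : \sum_(0 <= i < N) g (i + h)%N = \sum_(h <= i < N + h) g i); last first.
    by rewrite -{2}[h]add0n big_addn addnK.
  by rewrite -big_cat_nat ?leq_addl.
have -> : \sum_(n < N) g n - \sum_(n < N) g (n + h)%N
    = \sum_(i < h) g i - \sum_(i < h) g (N + i)%N.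
  by apply/eqP; rewrite subr_eq addrAC eq_sym subr_eq eq_sym e addrC.
rewrite natrD; apply: le_trans (ler_normB _ _) _.
have := norm_sum_le1 (fun i : 'I_h => i) g1.
have := norm_sum_le1 (fun i : 'I_h => (N + i)%N) g1.
by rewrite card_ord => ? ?; apply: lerD.
Qed.

(** Average the sum S over its shifts by h < H. Cauchy-Schwarz in n bounds |Z|^2 by N times the sum
    of all pair correlations. The H diagonal pairs contribute N each; the fewer than H^2 others are
    eventually at most N / H each by hypothesis. Hence |Z|^2 is at most 2HN^2. *)
Lemma van_der_corput g : (forall n, `|g n| = 1) ->
  (forall h h' : nat, (h' < h)%N ->
    mean0 (fun n => g (n + h)%N * (g (n + h')%N)^*)) ->
  mean0 g.
Proof.
move=> g1 g0 q.
have [->|q0] := posnP q; first by exists 0%N => N _; rewrite mul0r ler0n.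
(* With this H, 2H is the square of 4q, so |Z| <= 4qN = HN / (2q), half of the target HN / q for H
   |S|. *)
pose H := (8 * q ^ 2)%N.
have H0 : (0 < H)%N by rewrite muln_gt0 expn_gt0 q0.
pose F (p : 'I_H * 'I_H) n := g (n + p.1)%N * (g (n + p.2)%N)^*.
have F0 p : p.1 != p.2 -> mean0 (F p).
  case: p => h h' /=; rewrite neq_ltn => /orP[lt|/g0//].
  apply: (_ : mean0 (fun n => (g (n + h')%N * (g (n + h)%N)^*)^*) -> _); last first.
    by apply: mean0_conj; exact: g0.
  move=> M r; have [N0 MN] := M r; exists N0 => N /MN.
  by under eq_bigr do rewrite rmorphM /= conjCK mulrC.
have [N0 N0P] := mean0_uniform H F0.
(* For N >= 4qH the shifting error 2H^2 is at most HN / (2q), the other half of the target. *)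
exists (maxn N0 (4 * q * H)) => N; rewrite geq_max => /andP[/N0P NP NH].
set S := \sum_(n < N) g n.
pose Z := \sum_(n < N) \sum_(h < H) g (n + h)%N.
have SZ : `|H%:R * S - Z| <= (2 * H * H)%:R.
  rewrite /Z exchange_big /= mulr_natl -[X in S *+ X]card_ord -sumr_const -sumrB.
  apply: le_trans (ler_norm_sum _ _ _) _.
  apply: (@le_trans _ _ (\sum_(h < H) (2 * H)%:R)).
    apply: ler_sum => h _; apply: le_trans (sum_shift_le _ _ g1) _.
    by rewrite ler_nat addnn -mul2n leq_mul2l /= ltnW.
  by rewrite sumr_const card_ord -mulrnA.
have ZZ : `|Z| ^+ 2 <= (2 * H * N ^ 2)%:R.
  apply: le_trans (sqr_norm_sum_le _) _; rewrite card_ord.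
  have -> : \sum_(i < N) `|\sum_(h < H) g (i + h)%N| ^+ 2
      = \sum_p \sum_(n < N) F p n.
    under eq_bigr do rewrite sqr_norm_sum pair_big /=.
    by rewrite exchange_big.
  have sum_ge0 : 0 <= \sum_p \sum_(n < N) F p n.
    have -> : \sum_p \sum_(n < N) F p n =
       \sum_(i < N) `|\sum_(h < H) g (i + h)%N| ^+ 2.
      under [RHS]eq_bigr do rewrite sqr_norm_sum pair_big /=.
      by rewrite [RHS]exchange_big.
    by apply: sumr_ge0 => i _; rewrite exprn_ge0.
  rewrite -(ger0_norm sum_ge0).
  rewrite (_ : (2 * H * N ^ 2)%:R = N%:R * (2 * H * N)%:R); last first.
    by rewrite -natrM; congr (_%:R); lia.
  rewrite ler_wpM2l //; apply: le_trans (ler_norm_sum _ _ _) _.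
  rewrite (bigID (fun p : 'I_H * 'I_H => p.1 == p.2)) /=.
  rewrite (_ : (2 * H * N)%:R = (H * N)%:R + (H * N)%:R); last first.
    by rewrite -natrD; congr (_%:R); lia.
  apply: lerD.
    rewrite (eq_bigr (fun=> N%:R)); last first.
      move=> [h h'] /= /eqP <-; rewrite (eq_bigr (fun=> 1)); last first.
        by move=> i _; rewrite /F /= -normCK g1 expr1n.
      by rewrite sumr_const card_ord ger0_norm.
    rewrite sumr_const -mulrnA ler_nat mulnC leq_mul2r; apply/orP; right.
    rewrite -(card_in_imset (f := fun p : 'I_H * 'I_H => p.1)).
      by apply: leq_trans (max_card _) _; rewrite card_ord.
    by move=> [a b] [c d]; rewrite !unfold_in /= => /eqP/val_inj-> /eqP/val_inj-> ->.
  rewrite -(ler_pM2l (x := H%:R)) ?ltr0n // mulr_sumr.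
  apply: (@le_trans _ _ (\sum_(p : 'I_H * 'I_H | p.1 != p.2) N%:R)).
    by apply: ler_sum => p /NP.
  rewrite sumr_const -mulrnA -natrM ler_nat mulnC mulnA leq_mul2r; apply/orP; right.
  by apply: leq_trans (max_card _) _; rewrite card_prod card_ord.
have {}ZZ : `|Z| <= (4 * q * N)%:R.
  rewrite -(ler_pXn2r (n := 2)) ?nnegrE //; apply: le_trans ZZ _.
  by rewrite -natrX ler_nat /H; nia.
rewrite -(ler_pM2l (x := H%:R)) ?ltr0n // mulrCA.
have HS : H%:R * `|S| <= (4 * q * N)%:R + (2 * H * H)%:R.
  rewrite addrC; apply: le_trans (lerD SZ ZZ).
  have := ler_normD (H%:R * S - Z) Z; rewrite subrK normrM normr_nat.
  by [].
apply: (@le_trans _ _ (q%:R * ((4 * q * N)%:R + (2 * H * H)%:R))).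
  by rewrite ler_wpM2l.
by rewrite -natrD -!natrM ler_nat; rewrite /H in NH *; nia.
Qed.

End MeanZero.

(** * Arithmetic of the circle, iterated differences and polynomial sequences *)

Section CircleTheory.
Variable R : realType.
Local Notation T := (circle R).
Implicit Types x y z : T.

Lemma complex_archi (x : R[i]) : exists n : nat, `|x| < n%:R.
Proof.
rewrite normc_def.
exists (Num.bound (Num.sqrt (complex.Re x ^+ 2 + complex.Im x ^+ 2))).
by rewrite -(rmorph_nat (real_complex R)) ltcR archi_boundP // sqrtr_ge0.
Qed.

Lemma cvalM x y : cval (x * y)%g = cval x * cval y.
Proof. by []. Qed.

Lemma cvalV x : cval (x^-1)%g = (cval x)^-1.
Proof. by []. Qed.

Lemma cval1 : cval (1%g : T) = 1.
Proof. by []. Qed.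

Lemma cvalX x n : cval (x ^+ n)%g = cval x ^+ n.
Proof. by elim: n => [|n IH]; rewrite ?expg0 // expgS exprS cvalM IH. Qed.

Lemma norm_cval x : `|cval x| = 1.
Proof. exact/eqP/cval_norm. Qed.

Lemma cval_neq0 x : cval x != 0.
Proof. by rewrite -normr_eq0 norm_cval oner_eq0. Qed.

Lemma cval_conj x : (cval x)^* = cval x^-1%g.
Proof.
by apply: (mulfI (cval_neq0 x)); rewrite -normCK norm_cval expr1n cvalV divff ?cval_neq0.
Qed.

Lemma cval_expgz x (n : int) : cval (expgz x n) = cval x ^ n.
Proof. by case: n => n /=; rewrite ?cvalV cvalX // NegzE -exprnN. Qed.

Lemma expgzD x (m n : int) : expgz x (m + n) = (expgz x m * expgz x n)%g.
Proof. by apply: val_inj; rewrite /= !cval_expgz expfzDr ?cval_neq0. Qed.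

Lemma expgzN x (n : int) : expgz x (- n) = (expgz x n)^-1%g.
Proof. by apply: val_inj; rewrite /= !cval_expgz invr_expz. Qed.

Lemma expgzM x (m n : int) : expgz x (m * n) = expgz (expgz x m) n.
Proof. by apply: val_inj; rewrite /= !cval_expgz exprz_exp. Qed.

Lemma homT1 (f : homT R) : f 1%g = 1%g.
Proof. by apply: (@mulgI _ (f 1%g)); rewrite -gmulfM !mulg1. Qed.

Lemma homTX (f : homT R) n : {morph f : x / (x ^+ n)%g}.
Proof. by move=> x; elim: n => [|n IH]; rewrite ?homT1 // !expgS gmulfM IH. Qed.

Lemma circle_expMn x y n : ((x * y) ^+ n = x ^+ n * y ^+ n)%g.
Proof. by apply: expgMn; exact: circle_commute. Qed.

Lemma circle_mulACA x y z t : (x * y * (z * t) = x * z * (y * t))%g.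
Proof.
by apply: val_inj => /=; ring.
Qed.

Lemma circle_invM x y : ((x * y)^-1 = x^-1 * y^-1)%g.
Proof. by rewrite invgM circle_commute. Qed.

Definition torsion x := exists2 n : nat, (0 < n)%N & (x ^+ n = 1)%g.

Definition seq_diff (g : nat -> T) : nat -> T := fun n => (g n.+1 * (g n)^-1)%g.

(* [g] is polynomial of degree at most [d], and [w] plays the role of [d`!]
   times the leading coefficient. *)
Definition polynomial_seq (d : nat) (w : T) (g : nat -> T) :=
  forall n, iter d seq_diff g n = w.

Implicit Types g h : nat -> T.

Lemma iter_diffM d g h :
  iter d seq_diff (fun n => g n * h n)%g =
  (fun n => iter d seq_diff g n * iter d seq_diff h n)%g.
Proof.
elim: d => //= d ->; apply/funext => n.
by rewrite /seq_diff circle_invM circle_mulACA.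
Qed.

Lemma iter_diff_shift d k g :
  iter d seq_diff (fun n => g (n + k)%N) = (fun n => iter d seq_diff g (n + k)%N).
Proof. by elim: d => //= d ->. Qed.

Lemma polynomial_seqM d w w' g h : polynomial_seq d w g -> polynomial_seq d w' h ->
  polynomial_seq d (w * w')%g (fun n => g n * h n)%g.
Proof. by move=> gw hw n; rewrite iter_diffM gw hw. Qed.

Lemma polynomial_seq_shift d k w g : polynomial_seq d w g ->
  polynomial_seq d w (fun n => g (n + k)%N).
Proof. by move=> gw n; rewrite iter_diff_shift. Qed.

Lemma polynomial_seqS d w g : polynomial_seq d.+1 w g = polynomial_seq d w (seq_diff g).
Proof. by rewrite /polynomial_seq iterSr. Qed.

Lemma polynomial_seq_diff1 d : polynomial_seq d 1%g (fun=> 1%g).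
Proof.
elim: d => [//|d IH]; rewrite polynomial_seqS.
by rewrite (_ : seq_diff _ = fun=> 1%g) //; apply/funext => n; rewrite /seq_diff mulgV.
Qed.

Lemma polynomial_seq_cst d c : (0 < d)%N -> polynomial_seq d 1%g (fun=> c).
Proof.
case: d => // d _; rewrite polynomial_seqS.
rewrite (_ : seq_diff _ = fun=> 1%g); first exact: polynomial_seq_diff1.
by apply/funext => n; rewrite /seq_diff mulgV.
Qed.

Lemma polynomial_seq_lt d e w g : (d < e)%N -> polynomial_seq d w g ->
  polynomial_seq e 1%g g.
Proof.
move=> de gw; rewrite -(subnK (ltnW de)) /polynomial_seq iterD.
rewrite (_ : iter d _ g = fun=> w); last by apply/funext.
by apply: polynomial_seq_cst; rewrite subn_gt0.
Qed.

(** The difference with step e is a product of e shifts of [seq_diff g], which all have the same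
    leading coefficient w. *)
Lemma polynomial_seq_ndiff d e w g : polynomial_seq d.+1 w g ->
  polynomial_seq d (w ^+ e)%g (fun n => g (n + e)%N * (g n)^-1)%g.
Proof.
move=> gw; elim: e => [|e IH].
  rewrite (_ : (fun _ => _) = fun=> 1%g); first exact: polynomial_seq_diff1.
  by apply/funext => n; rewrite addn0 mulgV.
rewrite (_ : (fun _ => _) =
    (fun n => seq_diff g (n + e)%N * (g (n + e)%N * (g n)^-1))%g).
  rewrite expgS; apply: polynomial_seqM IH.
  by apply: polynomial_seq_shift; rewrite -polynomial_seqS.
by apply/funext => n; rewrite /seq_diff mulgA mulgVK addnS.
Qed.

(** Passing to step M multiplies each of the d differences by M, hence the power M^d of the leading
    coefficient. *)
Lemma polynomial_seq_progression d a M w g : polynomial_seq d w g ->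
  polynomial_seq d (w ^+ (M ^ d))%g (fun n => g (a + M * n)%N).
Proof.
elim: d w g => [|d IH] w g gw; first by move=> n; rewrite expg1; exact: gw.
rewrite polynomial_seqS expnS expgnA.
rewrite (_ : seq_diff _ =
  (fun n => (fun i => g (i + M)%N * (g i)^-1) (a + M * n)%N)%g).
  exact: (IH _ _ (polynomial_seq_ndiff M gw)).
by apply/funext => n; rewrite /seq_diff mulnS addnCA addnC.
Qed.

(** Pascal's rule: one difference turns the exponent C(n, k + 1) into C(n, k). *)
Lemma polynomial_seq_bin k x : polynomial_seq k x (fun n => x ^+ 'C(n, k))%g.
Proof.
elim: k => [|k IH]; first by move=> n /=; rewrite bin0.
rewrite polynomial_seqS (_ : seq_diff _ = fun n => x ^+ 'C(n, k))%g //.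
by apply/funext => n; rewrite /seq_diff binS addnC expgnDr mulgK.
Qed.

(** Induction on the degree, starting at 1. There g is geometric with ratio w, distinct from 1, so
    its sums are bounded by 2 / |w - 1|. In higher degree the correlation of the shifts by h and h'
    has degree one less and leading coefficient w^(h - h'), again of infinite order, and van der
    Corput's inequality applies. *)
Lemma mean0_polynomial_seq d w g : (0 < d)%N -> ~ torsion w -> polynomial_seq d w g ->
  mean0 (fun n => cval (g n)).
Proof.
case: d => // d _; elim: d w g => [|d IH] w g wT gw.
  have w1 : cval w - 1 != 0.
    rewrite subr_eq0; apply/eqP => /(@val_inj _ _ _ w 1%g) w1.
    by apply: wT; exists 1%N; rewrite ?expg1.
  move=> q; have [N0 N0P] := complex_archi (2 * q%:R / (cval w - 1)).
  exists N0 => N leN.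
  have tele : (cval w - 1) * \sum_(n < N) cval (g n) = cval (g N) - cval (g 0%N).
    rewrite mulr_sumr -(telescope_sumr (fun n => cval (g n))) // big_mkord.
    apply: eq_bigr => i _; rewrite mulrBl mul1r; congr (_ - _).
    suff <- : (w * g i)%g = g i.+1 by [].
    by rewrite -(gw i) /= /seq_diff mulgVK.
  have {}tele : `|cval w - 1| * `|\sum_(n < N) cval (g n)| <= 2.
    rewrite -normrM tele; apply: le_trans (ler_normB _ _) _.
    by rewrite !norm_cval.
  have nw : 0 < `|cval w - 1| by rewrite normr_gt0.
  rewrite -(ler_pM2l nw) mulrCA.
  apply: (@le_trans _ _ (q%:R * 2)); first by rewrite ler_wpM2l.
  rewrite mulrC [leRHS]mulrC -ler_pdivrMr //.
  apply: (@le_trans _ _ N0%:R); last by rewrite ler_nat.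
  apply/ltW; move: N0P; rewrite !normrM normfV !normr_nat.
  by rewrite [2 * _]mulrC.
apply: van_der_corput => [n|h h' lth]; first by rewrite norm_cval.
have := @IH (w ^+ (h - h'))%g (fun n => g (n + h)%N * (g (n + h')%N)^-1)%g.
have -> : (fun n => cval (g (n + h)%N * (g (n + h')%N)^-1)%g) =
  fun n => cval (g (n + h)%N) * (cval (g (n + h')%N))^*.
  by apply/funext => n; rewrite cvalM cval_conj.
apply.
  move=> [e e0 we]; apply: wT; exists ((h - h') * e)%N; last by rewrite expgnA.
  by rewrite muln_gt0 subn_gt0 lth.
have := polynomial_seq_shift h' (polynomial_seq_ndiff (h - h') gw).
by under eq_fun do rewrite -addnA [(h' + _)%N]addnC subnK 1?ltnW//.
Qed.

End CircleTheory.

(** * A quantitative form of Weyl's criterion with bounded exponents *)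

(** Average the squared modulus over n < N. Pairs with correlation constantly 1 include the
    diagonal, so their weight is at least 1 / |J| by Cauchy-Schwarz; for large N the other pairs
    contribute at most 1 / (2|J|) in modulus. A uniform upper bound [rho] is therefore at least 1 /
    (2|J|). *)
Lemma mean_sqr_norm_ge (C : numClosedFieldType) (J : finType) (c : J -> C)
    (e : J -> nat -> C) (rho : C) :
  (forall f, 0 <= c f) -> \sum_f c f = 1 ->
  (forall f g, (forall n, e f n * (e g n)^* = 1) \/
     mean0 (fun n => e f n * (e g n)^*)) ->
  (forall f n, `|e f n| = 1) ->
  (forall n, `|\sum_f c f * e f n| ^+ 2 <= rho) ->
  1 <= 2 * #|J|%:R * rho.
Proof.
move=> c0 c1 eP e1 erho.
pose E (p : J * J) n := e p.1 n * (e p.2 n)^*.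
pose G (p : J * J) := `[< forall n, E p n = 1 >].
pose w (p : J * J) := c p.1 * c p.2.
have w0 p : 0 <= w p by rewrite mulr_ge0.
have wsum : \sum_p w p = 1.
  rewrite -(pair_bigA _ (fun i j => c i * c j)) /=.
  by under eq_bigr do rewrite -mulr_sumr c1 mulr1.
have Gdiag f : G (f, f).
  by apply/asboolP => n; rewrite /E /= -normCK e1 expr1n.
have cc : 1 <= #|J|%:R * \sum_(p | G p) w p.
  have := sqr_norm_sum_le c; rewrite c1 normr1 expr1n => /le_trans; apply.
  rewrite ler_wpM2l //.
  rewrite [leRHS](bigID (fun p : J * J => p.1 == p.2)) /= -[leLHS]addr0.
  apply: lerD; last by apply: sumr_ge0.
  rewrite le_eqVlt; apply/orP; left; apply/eqP.
  rewrite (reindex_onto (fun f : J => (f, f)) fst) /=; last first.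
    by move=> [a b] /andP[_ /eqP/= ->].
  apply: eq_big => [f|f _]; first by rewrite Gdiag !eqxx.
  by rewrite ger0_norm.
have [N0 N0P] : exists N0 : nat, forall N : nat, (N0 <= N)%N -> forall p,
    ~~ G p -> (2 * #|J|)%:R * `|\sum_(n < N) E p n| <= N%:R.
  apply: mean0_uniform => p /asboolP Gp.
  by case: (eP p.1 p.2) => // /Gp.
pose N := N0.+1; have {N0P}NP := N0P N (leqnSn _).
have Ngt0 : 0 < N%:R :> C by rewrite ltr0n.
have tot : \sum_(n < N) `|\sum_f c f * e f n| ^+ 2 = \sum_p w p * \sum_(n < N) E p n.
  under eq_bigr do rewrite sqr_norm_sum pair_big /=.
  rewrite exchange_big; apply: eq_bigr => p _; rewrite mulr_sumr.
  apply: eq_bigr => n _; rewrite rmorphM /= (CrealP _) ?ger0_real // /w /E.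
  ring.
have totle : \sum_(n < N) `|\sum_f c f * e f n| ^+ 2 <= N%:R * rho.
  rewrite mulr_natl -[X in _ *+ X]card_ord -sumr_const.
  by apply: ler_sum => n _.
have totge : 0 <= \sum_(n < N) `|\sum_f c f * e f n| ^+ 2.
  by apply: sumr_ge0 => n _; rewrite exprn_ge0.
have split_tot : \sum_p w p * \sum_(n < N) E p n =
    N%:R * \sum_(p | G p) w p + \sum_(p | ~~ G p) w p * \sum_(n < N) E p n.
  rewrite (bigID G) /= mulr_sumr; congr (_ + _); apply: eq_bigr => p /asboolP Gp.
  by under eq_bigr do rewrite Gp; rewrite sumr_const card_ord mulrC.
set S := \sum_(p | ~~ G p) _ in split_tot.
have Sle : (2 * #|J|)%:R * `|S| <= N%:R.
  apply: (@le_trans _ _ (\sum_(p | ~~ G p) w p * N%:R)); last first.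
    rewrite -mulr_suml ler_piMl // -wsum [leRHS](bigID G) /= lerDr.
    by apply: sumr_ge0.
  apply: (@le_trans _ _ (\sum_(p | ~~ G p)
      w p * ((2 * #|J|)%:R * `|\sum_(n < N) E p n|))).
    rewrite -(normr_nat C (2 * #|J|)) -normrM mulr_sumr.
    apply: le_trans (ler_norm_sum _ _ _) _; apply: ler_sum => p _.
    by rewrite normrM [X in _ * X <= _]normrM (ger0_norm (w0 p)) mulrCA.
  by apply: ler_sum => p Gp; rewrite ler_wpM2l // NP.
have main : N%:R * \sum_(p | G p) w p <= N%:R * rho + `|S|.
  have -> : N%:R * \sum_(p | G p) w p =
      \sum_(n < N) `|\sum_f c f * e f n| ^+ 2 - S by rewrite tot split_tot addrK.
  have r1 : 0 <= \sum_(n < N) `|\sum_f c f * e f n| ^+ 2 - S.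
    rewrite tot split_tot addrK mulr_ge0 //.
    by apply: sumr_ge0.
  rewrite -(ger0_norm r1); apply: le_trans (ler_normB _ _) _.
  by rewrite lerD2r ger0_norm.
have K0 : 0 <= (2 * #|J|)%:R :> C by rewrite ler0n.
have := ler_wpM2l K0 main; rewrite mulrDr => /le_trans/(_ (lerD (lexx _) Sle)).
rewrite natrM => main2.
rewrite -(ler_pM2l Ngt0) mulr1.
rewrite -(lerD2r N%:R).
apply: le_trans (_ : N%:R * (2 * (#|J|%:R * \sum_(p | G p) w p)) <= _).
  rewrite -{1}(mulr1 N%:R) -{2}(mulr1 N%:R) -mulrDr ler_pM2l //.
  by rewrite -[leLHS]/2 -{1}(mulr1 2) ler_pM2l.
apply: le_trans (le_trans main2 _); rewrite le_eqVlt; apply/orP; left; apply/eqP; ring.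
Qed.

(** By Bernoulli's inequality r^l is at most 1 / (l h), with h = 1 - r. For L = l(d + 1) this makes
    r^L at most (l h)^-(d + 1), one power of l better than the growth of (L + 1)^d. *)
Lemma geometric_poly_small (R : realType) (r : R) (d : nat) : 0 <= r -> r < 1 ->
  exists L : nat, 2 * (L.+1%:R) ^+ d * r ^+ L < 1.
Proof.
move=> r0 r1; pose h := 1 - r.
have h0 : 0 < h by rewrite subr_gt0.
have bern l : r ^+ l * (1 + l%:R * h) <= 1.
  elim: l => [|l IH]; first by rewrite expr0 mul0r addr0 mulr1.
  apply: le_trans IH; rewrite exprSr -mulrA ler_wpM2l ?exprn_ge0 //.
  have -> : r = 1 - h by rewrite /h; lra.
  rewrite -(natr1 l); have : 0 <= (l%:R : R) by rewrite ler0n.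
  by move=> ?; nra.
(* Since L + 1 = l(d + 1) + 1 <= l(d + 2), it is enough that l h^(d + 1) exceeds 2(d + 2)^d. *)
have [l lP] : exists l : nat, 2 * (d.+2%:R) ^+ d / h ^+ d.+1 < l%:R.
  eexists; apply: archi_boundP; rewrite divr_ge0 ?mulr_ge0 ?exprn_ge0 //.
  exact: ltW.
have l0 : (0 < l)%N.
  rewrite -(ltr0n R); apply: le_lt_trans lP.
  by rewrite divr_ge0 ?mulr_ge0 ?exprn_ge0 // ltW.
exists (l * d.+1)%N; rewrite exprM.
set t := r ^+ l in bern *.
have t0 : 0 <= t by rewrite exprn_ge0.
have lh : t * (l%:R * h) <= 1.
  apply: le_trans (bern l); rewrite -/t ler_wpM2l //; lra.
have lh0 : 0 < l%:R * h by rewrite mulr_gt0 // ltr0n.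
have lhd : t ^+ d.+1 * (l%:R * h) ^+ d.+1 <= 1.
  by rewrite -exprMn exprn_ile1 // mulr_ge0 // ltW.
rewrite -(ltr_pM2r (exprn_gt0 d.+1 lh0)) mul1r.
apply: (@le_lt_trans _ _ (2 * (l * d.+1).+1%:R ^+ d)).
  by rewrite -[X in X <= _]mulrA -[X in _ <= X]mulr1 ler_wpM2l ?mulr_ge0 ?exprn_ge0.
apply: (@le_lt_trans _ _ (2 * ((l%:R * d.+2%:R) ^+ d))).
  rewrite ler_wpM2l // lerXn2r ?nnegrE ?mulr_ge0 //.
  by rewrite -natrM ler_nat; nia.
rewrite ltr_pdivrMr ?exprn_gt0 // in lP.
rewrite !exprMn exprSr (_ : 2 * _ = l%:R ^+ d * (2 * d.+2%:R ^+ d)); last by ring.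
by rewrite -mulrA ltr_pM2l // exprn_gt0 // ltr0n.
Qed.

(** The test function is the product of ((1 + v_i) / 2)^L, a convex combination of (L + 1)^|I|
    monomials. If every n had a coordinate away from 1, its squared modulus would stay below r^L,
    against the lower bound of [mean_sqr_norm_ge]. L is found before [u], so the monomials to be
    tested form a finite set known in advance. *)
Lemma weyl_density (R : realType) (I : finType) (eps : R[i]) : 0 < eps ->
  exists L : nat, forall u : I -> nat -> circle R,
    (forall f g : {ffun I -> 'I_L.+1},
       let chi n := \prod_i (cval (u i n) ^+ f i * (cval (u i n))^* ^+ g i) in
       (forall n, chi n = 1) \/ mean0 chi) ->
    exists n, forall i, `|cval (u i n) - 1| < eps.
Proof.
move=> eps0.
(* A positive element of [R[i]] is real; it is replaced by a real number of size at most 1, which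
   gives 0 <= r < 1 below. *)
have [eps' /andP[e0 e1] eeps] : exists2 e : R, 0 < e <= 1 & real_complex R e <= eps.
  case: eps eps0 => [a b]; rewrite ltcE /= => /andP[/eqP b0 a0]; rewrite b0.
  exists (Num.min a 1); first by rewrite lt_min a0 ltr01 ge_min lexx orbT.
  by rewrite lecE /= eqxx ge_min lexx.
(* On the circle |(1 + x) / 2|^2 = 1 - |x - 1|^2 / 4, which is at most r when x is at distance at
   least [eps] from 1. *)
pose r := 1 - eps' ^+ 2 / 4.
have r0 : 0 <= r by rewrite /r; nra.
have r1 : r < 1 by rewrite /r; nra.
have [L LP] := geometric_poly_small #|I| r0 r1.
exists L => u uP; apply: contrapT => /forallNP noN.
pose c (f : {ffun I -> 'I_L.+1}) : R[i] := \prod_i ('C(L, f i)%:R / 2 ^+ L).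
pose e (f : {ffun I -> 'I_L.+1}) n : R[i] := \prod_i cval (u i n) ^+ f i.
have sumE (v : I -> R[i]) : \sum_f c f * \prod_i v i ^+ f i
    = \prod_i ((1 + v i) / 2) ^+ L.
  rewrite (eq_bigr (fun f : {ffun I -> 'I_L.+1} =>
    \prod_i ('C(L, f i)%:R / 2 ^+ L * v i ^+ f i))); last first.
    by move=> f _; rewrite big_split.
  rewrite -(bigA_distr_bigA (fun i (a : 'I_L.+1) => 'C(L, a)%:R / 2 ^+ L * v i ^+ a)).
  apply: eq_bigr => i _; rewrite expr_div_n [(1 + v i) ^+ L]exprDn mulr_suml.
  apply: eq_bigr => a _.
  by rewrite expr1n mul1r -[v i ^+ a *+ _]mulr_natl mulrAC.
have csum : \sum_f c f = 1.
  have := sumE (fun=> 1); rewrite [X in _ = X]big1; last first.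
    by move=> i _; rewrite -[1 + 1]/2 divff ?expr1n // pnatr_eq0.
  move=> <-; apply: eq_bigr => f _; rewrite big1 ?mulr1 // => i _.
  by rewrite expr1n.
have c0 f : 0 <= c f by apply: prodr_ge0 => i _; rewrite divr_ge0 ?exprn_ge0.
have e1' f n : `|e f n| = 1.
  by rewrite normr_prod big1 // => i _; rewrite normrX norm_cval expr1n.
have eP f g : (forall n, e f n * (e g n)^* = 1) \/ mean0 (fun n => e f n * (e g n)^*).
  have -> : (fun n => e f n * (e g n)^*) =
    fun n => \prod_i (cval (u i n) ^+ f i * (cval (u i n))^* ^+ g i).
    apply/funext => n; rewrite rmorph_prod -big_split; apply: eq_bigr => i _.
    by rewrite rmorphXn.
  case: (uP f g) => h; last by right.
  left => n; rewrite -[RHS](h n) rmorph_prod -big_split; apply: eq_bigr => i _.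
  by rewrite rmorphXn.
have bound n : `|\sum_f c f * e f n| ^+ 2 <= real_complex R (r ^+ L).
  rewrite sumE normr_prod -prodrXl.
  have half (x : circle R) : `|(1 + cval x) / 2| ^+ 2 = 1 - `|cval x - 1| ^+ 2 / 4.
    have xx : cval x * (cval x)^* = 1 by rewrite -normCK norm_cval expr1n.
    have -> : `|cval x - 1| ^+ 2 = 2 - cval x - (cval x)^*.
      by rewrite normCK rmorphB rmorph1 mulrBl !mulrBr xx; ring.
    rewrite normrM normfV normr_nat exprMn exprVn.
    have -> : `|1 + cval x| ^+ 2 = 2 + cval x + (cval x)^*.
      by rewrite normCK rmorphD rmorph1 mulrDl !mulrDr xx; ring.
    by field.
  have [i /negP uin] : exists i, ~ `|cval (u i n) - 1| < eps by apply/existsNP/noN.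
  rewrite (bigD1 i) //= -[leRHS]mulr1; apply: ler_pM.
  - by rewrite exprn_ge0.
  - by apply: prodr_ge0 => j _; rewrite exprn_ge0.
  - rewrite normrX exprAC rmorphXn; apply: lerXn2r; rewrite ?nnegrE ?exprn_ge0 //.
      by rewrite lecE /= eqxx.
    rewrite half /r rmorphB rmorph1 rmorphM fmorphV rmorph_nat rmorphXn.
    rewrite lerB // ler_pM2r ?invr_gt0 ?ltr0n //.
    apply: lerXn2r; rewrite ?nnegrE //; first by rewrite lecE /= eqxx ltW.
    apply: le_trans eeps _; rewrite real_leNgt // ?normr_real //.
    by rewrite realE ltW.
  apply: prodr_ile1 => j _; rewrite exprn_ge0 //= normrX exprAC exprn_ile1 ?exprn_ge0 //.
  by rewrite half gerBl divr_ge0 ?exprn_ge0.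
have := mean_sqr_norm_ge c0 csum eP e1' bound.
rewrite card_ffun card_ord natrX -(rmorph_nat (real_complex R) L.+1).
rewrite -(rmorph_nat (real_complex R) 2) -rmorphXn -!rmorphM -(rmorph1 (real_complex R)).
by rewrite lecR leNgt LP.
Qed.

(** * Roots of unity, where homomorphisms are power maps, and the Stirling relation there *)

Section LocalPowers.
Variable R : realType.
Local Notation T := (circle R).
Implicit Types x y : T.

Lemma expi0 : expi 0 = 1%g :> T.
Proof. by apply: val_inj; rewrite /= cos0 sin0. Qed.

Lemma expiD (s t : R) : expi (s + t) = (expi s * expi t)%g.
Proof.
apply/val_inj/eqP; rewrite eq_complex /= cosD sinD.
by apply/andP; split; apply/eqP; ring.
Qed.

Lemma expiX (t : R) n : (expi t ^+ n)%g = expi (t * n%:R).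
Proof.
elim: n => [|n IH]; first by rewrite expg0 mulr0 expi0.
by rewrite expgS -natr1 mulrDr mulr1 addrC expiD IH.
Qed.

Lemma expiN (t : R) : expi (- t) = (expi t)^-1%g.
Proof. by apply: (@mulgI _ (expi t)); rewrite -expiD subrr mulgV expi0. Qed.

Lemma expi_2pi_nat n : expi (2 * pi * n%:R) = 1%g :> T.
Proof.
rewrite -expiX (_ : expi _ = 1%g) ?expg1n //.
by apply: val_inj; rewrite /= mulr_natl cos2pi sin2pi.
Qed.

Lemma expi_neq1 (t : R) : 0 < t < 2 * pi -> expi t <> 1%g.
Proof.
move=> /andP[t0 t2] /(congr1 (fun x : T => complex.Re (cval x))) /= cost.
have : 0 < sin (t / 2) by apply: sin_gt0_pi; rewrite divr_gt0 //= ltr_pdivrMr // mulrC.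
have := cos_mulr2n (t / 2); have -> : t / 2 *+ 2 = t by rewrite mulr2n; field.
rewrite cost.
move=> c; have := cos2Dsin2 (t / 2); rewrite -[_ *+ 2]mulr_natl in c.
by move=> ? ?; nra.
Qed.

Lemma expi_primitive n : (0 < n)%N ->
  n.-primitive_root (cval (expi (2 * pi / n%:R) : T)).
Proof.
move=> n0; have nR : (n%:R : R) != 0 by rewrite pnatr_eq0 -lt0n.
rewrite /primitive_root_of_unity n0; apply/forallP => i; rewrite unity_rootE.
apply/eqP; rewrite -cvalX expiX.
have [->|ni] := eqVneq i.+1 n.
  by rewrite divfK // -[2 * pi]mulr1 (expi_2pi_nat 1) eqxx.
apply/negbTE/eqP => /(@val_inj _ _ _ _ (1%g : T)); apply: expi_neq1.
have pi2 : 0 < 2 * pi :> R by rewrite mulr_gt0 // pi_gt0.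
apply/andP; split; first by rewrite mulr_gt0 ?ltr0n // divr_gt0 // ltr0n.
rewrite -[ltLHS]mulrA gtr_pMr // mulrC ltr_pdivrMr ?ltr0n // mul1r.
by rewrite ltr_nat ltn_neqAle ni ltn_ord.
Qed.

Lemma root_of_unityP n x : (0 < n)%N -> (x ^+ n = 1)%g ->
  exists i : nat, x = (expi (2 * pi / n%:R) ^+ i)%g.
Proof.
move=> n0 xn; have xn1 : cval x ^+ n = 1 by rewrite -cvalX xn.
have [i xi] := prim_rootP (expi_primitive n0) xn1.
by exists i; apply: val_inj; rewrite [RHS]cvalX -xi.
Qed.

Lemma TQP x : TQ x <-> torsion x.
Proof.
split=> [[q _ <-]|[n n0 xn]].
  have d0 : (denq q)%:~R != 0 :> R by rewrite intr_eq0 denq_neq0.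
  exists `|denq q|%N; first by rewrite absz_gt0 denq_neq0.
  rewrite expiX natr_absz gtr0_norm // -mulrA.
  rewrite (_ : ratr q * _ = (numq q)%:~R); last by rewrite /ratr divfK.
  case: (numq q) => k; first exact: expi_2pi_nat.
  by rewrite NegzE mulrNz mulrN expiN expi_2pi_nat invg1.
have [i ->] := root_of_unityP n0 xn; exists (i%:Q / n%:Q) => //.
rewrite expiX; congr (expi _).
by rewrite rmorphM fmorphV /= !ratr_int -!pmulrn mulrA mulrAC.
Qed.

Lemma circle_root x n : (0 < n)%N -> exists y, (y ^+ n = x)%g.
Proof.
move=> n0; have yx := rootCK n0 (cval x).
have y1 : `|n.-root (cval x)| == 1.
  by rewrite -(pexpr_eq1 n0) // -normrX yx norm_cval.
by exists (Circle y1); apply: val_inj; rewrite [LHS]cvalX.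
Qed.

Lemma torsion1 : torsion (1%g : T).
Proof. by exists 1%N. Qed.

Lemma torsionM x y : torsion x -> torsion y -> torsion (x * y)%g.
Proof.
move=> [m m0 xm] [n n0 yn]; exists (m * n)%N; first by rewrite muln_gt0 m0.
by rewrite circle_expMn [in (y ^+ _)%g]mulnC !expgnA xm yn !expg1n mulg1.
Qed.

Lemma torsionV x : torsion x -> torsion x^-1%g.
Proof. by move=> [m m0 xm]; exists m => //; rewrite expVgn xm invg1. Qed.

Lemma torsionX x n : torsion x -> torsion (x ^+ n)%g.
Proof.
by elim: n => [|n IH] xt; [exact: torsion1|rewrite expgS; apply/torsionM/IH].
Qed.

Lemma expg_dvd x m n : (m %| n)%N -> (x ^+ m = 1)%g -> (x ^+ n = 1)%g.
Proof. by move=> /dvdnP[k ->] xm; rewrite mulnC expgnA xm expg1n. Qed.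

(** The M-th roots of unity form a cyclic group that f preserves, so f is determined by the image of
    a generator; the exponent matters only modulo M. *)
Lemma hom_power_on_roots (f : homT R) M : (0 < M)%N ->
  exists a : nat, forall l x, (x ^+ M = 1)%g -> f x = (x ^+ (a + M * l))%g.
Proof.
move=> M0; set z : T := expi (2 * pi / M%:R).
have zM : (z ^+ M = 1)%g.
  by apply: val_inj; rewrite [LHS]cvalX (prim_expr_order (expi_primitive M0)).
have fz : (f z ^+ M = 1)%g by rewrite -homTX zM homT1.
have [a fa] := root_of_unityP M0 fz.
exists a => l x xM; rewrite expgnDr expgnA xM expg1n mulg1.
have [b ->] := root_of_unityP M0 xM.
by rewrite homTX fa -!expgnA mulnC.
Qed.

Lemma iter_power (f : homT R) M n j x :
  (forall y, (y ^+ M = 1)%g -> f y = (y ^+ n)%g) ->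
  (x ^+ M = 1)%g -> iter j f x = (x ^+ (n ^ j))%g.
Proof.
move=> fn xM; elim: j => [|j IH] /=; first by rewrite expg1.
rewrite IH fn; first by rewrite -expgnA -expnSr.
by rewrite expgnAC xM expg1n.
Qed.

(** Evaluate the defining polynomial at n: for n < k one factor vanishes. The sum may start at 1
    because the factor X kills the constant coefficient. *)
Lemma sum_stirling1 (k n : nat) : (0 < k)%N ->
  \sum_(1 <= j < k.+1) stirling1 k j * (n%:Z ^+ j) = (n ^_ k)%:Z.
Proof.
move=> k0; set p : {poly int} := \prod_(i < k) ('X - (i%:Z)%:P).
have sp : size p = k.+1.
  by rewrite size_prod_XsubC [index_enum _]unlock -enumT size_enum_ord.
have : p.[n%:Z] = (n ^_ k)%:Z.
  rewrite /p horner_prod; under eq_bigr do rewrite hornerXsubC.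
  have [kn|nk] := leqP k n.
    rewrite ffact_prod (big_morph Posz PoszM erefl); apply: eq_bigr => i _.
    by rewrite subzn // ltnW // (leq_trans (ltn_ord i)).
  rewrite ffact_small // (bigD1 (Ordinal nk)) //= subrr mul0r //.
move=> <-; rewrite horner_coef sp.
rewrite -(big_mkord xpredT (fun i => p`_i * n%:Z ^+ i)) (big_ltn (ltn0Sn k)).
suff -> : p`_0 = 0 by rewrite mul0r add0r.
rewrite -horner_coef0 /p horner_prod; case: k k0 {p sp} => // k _.
by rewrite big_ord_recl hornerXsubC subrr mul0r.
Qed.

Lemma prod_stirling1 (f : homT R) M n k x : (0 < k)%N ->
  (forall y, (y ^+ M = 1)%g -> f y = (y ^+ n)%g) -> (x ^+ M = 1)%g ->
  (\prod_(1 <= j < k.+1) iter j f (expgz x (stirling1 k j)))%g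
    = (x ^+ (n ^_ k))%g.
Proof.
move=> k0 fn xM; rewrite -[RHS]/(expgz x (n ^_ k)%:Z) -sum_stirling1 //.
rewrite (big_morph (expgz x) (expgzD x) (erefl : expgz x 0 = 1%g)).
apply: eq_bigr => j _; rewrite (iter_power _ fn).
  by rewrite expgzM -rmorphXn.
apply: val_inj; rewrite [LHS]cvalX cval_expgz exprnP exprz_exp mulrC.
by rewrite -exprz_exp -exprnP -cvalX xM cval1 exp1rz.
Qed.

(** Write x = y^(k!) with y of order dividing M k!. The relation at y gives y to the falling
    factorial of n, which is k! C(n, k). This is why f must be known on a larger group of roots than
    g. *)
Lemma stirling_rel_power (f g : homT R) M n k : (0 < k)%N ->
  (forall y, (y ^+ (M * k`!) = 1)%g -> f y = (y ^+ n)%g) ->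
  (0 < M)%N ->
  stirling_rel f k g -> forall x, (x ^+ M = 1)%g -> g x = (x ^+ 'C(n, k))%g.
Proof.
move=> k0 fn M0 fg x xM; have [y yx] := circle_root x (fact_gt0 k).
have yM : (y ^+ (M * k`!) = 1)%g by rewrite mulnC expgnA yx.
have yQ : TQ y by apply/TQP; exists (M * k`!)%N => //; rewrite muln_gt0 M0 fact_gt0.
have := fg _ yQ; rewrite yx (prod_stirling1 k0 fn yM) => ->.
by rewrite -bin_ffact mulnC expgnA yx.
Qed.

Lemma calH_power (phi : {ptws nat -> homT R}) M m : (0 < M)%N -> calH phi ->
  exists a Q : nat, [/\ (0 < a)%N, (0 < Q)%N & forall l k x, (k <= m)%N ->
    (x ^+ M = 1)%g -> phi k x = (x ^+ 'C(a + Q * l, k))%g].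
Proof.
move=> M0 [phi0 phiP]; have Q0 : (0 < M * m`!)%N by rewrite muln_gt0 M0 fact_gt0.
have [a aP] := hom_power_on_roots (phi 1%N) Q0.
(* One period is added to the exponent, which may be 0, to make the start of the progression
   positive. *)
exists (a + M * m`!)%N, (M * m`!)%N; split=> [|//|l [|k] x km xM].
- by rewrite addn_gt0 Q0 orbT.
- by rewrite phi0 bin0.
- apply: (stirling_rel_power _ _ M0 (phiP k.+1 isT)) => // y yM.
  rewrite -addnA -mulnS; apply: aP; apply: expg_dvd yM.
  by rewrite dvdn_pmul2l // (fact_split km) dvdn_mulr.
Qed.

(** Converse of [calH_power]: a single suitable n for each order and each bound on k suffices. It is
    the criterion by which membership in [calH] is checked later. *)
Lemma power_calH (phi : {ptws nat -> homT R}) : phi 0%N = powT R 1 ->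
  (forall M m, (0 < M)%N -> exists n : nat, forall k x, (k <= m)%N ->
    (x ^+ M = 1)%g -> phi k x = (x ^+ 'C(n, k))%g) ->
  calH phi.
Proof.
move=> phi0 phiP; split=> // k k0 x /TQP[M M0 xM].
have [n nP] := phiP M k M0; rewrite nP //; last by rewrite expgnAC xM expg1n.
rewrite (@prod_stirling1 _ M n) //; last first.
  by move=> y yM; rewrite nP // bin1.
by rewrite -expgnA mulnC bin_ffact.
Qed.

End LocalPowers.

(** * Simultaneous approximation of finitely many values by orbit points *)

Section Density.
Variable R : realType.
Local Notation T := (circle R).

(* Newton's expansion along the progression [a + Q * N]: the last index [k] for
   which [X k] has infinite order determines the degree. *)
Lemma mean0_binomial_chars (phi : nat -> homT R) (a Q m : nat) (X : nat -> T) :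
  phi 0%N = powT R 1 -> (0 < Q)%N ->
  (forall k, (k <= m)%N -> torsion (X k) ->
    forall l, phi k (X k) = (X k ^+ 'C(a + Q * l, k))%g) ->
  let P l := (\prod_(k < m.+1) (X k ^+ 'C(a + Q * l, k) * (phi k (X k))^-1))%g in
  (forall l, P l = 1%g) \/ mean0 (fun l => cval (P l)).
Proof.
move=> phi0 Q0 Xtor /=.
pose E k (l : nat) : T := (X k ^+ 'C(a + Q * l, k) * (phi k (X k))^-1)%g.
have Epoly k : (0 < k)%N -> polynomial_seq k (X k ^+ (Q ^ k))%g (E k).
  move=> k0; rewrite -[(_ ^+ _)%g]mulg1; apply: polynomial_seqM.
    exact: (polynomial_seq_progression a Q (polynomial_seq_bin k (X k))).
  exact: polynomial_seq_cst.
have E0 l : E 0%N l = 1%g by rewrite /E bin0 phi0 expg1 mulgV.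
have Etor k l : (k <= m)%N -> torsion (X k) -> E k l = 1%g.
  by move=> km tX; rewrite /E (Xtor _ km tX l) mulgV.
pose P n l : T := (\prod_(k < n.+1) E k l)%g.
have PS n : P n.+1 = fun l => (P n l * E n.+1 l)%g.
  by apply/funext => l; rewrite /P big_ord_recr.
have P0 l : P 0%N l = 1%g by rewrite /P big_ord1.
have Plow n : polynomial_seq n.+1 1%g (P n).
  elim: n => [|n IH].
    by rewrite (_ : P 0%N = fun=> 1%g); [exact: polynomial_seq_cst|exact/funext].
  rewrite PS -[1%g]mulg1; apply: polynomial_seqM; first exact: polynomial_seq_lt IH.
  by apply: polynomial_seq_lt (Epoly _ _).
suff : forall n, (n <= m)%N -> (forall l, P n l = 1%g) \/
    exists d w, [/\ (0 < d)%N, ~ torsion w & polynomial_seq d w (P n)].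
  move=> /(_ m (leqnn m))[|[d [w [d0 wt Pw]]]]; first by left.
  by right; apply: mean0_polynomial_seq d0 wt Pw.
elim=> [|n IH] nm; first by left.
have [tX|nX] := pselect (torsion (X n.+1)).
  have -> : P n.+1 = P n by rewrite PS; apply/funext => l; rewrite Etor ?mulg1.
  exact/IH/ltnW.
right; exists n.+1, (X n.+1 ^+ (Q ^ n.+1))%g; split=> //.
  move=> [e e0 Xe]; apply: nX; exists (Q ^ n.+1 * e)%N; last by rewrite expgnA.
  by rewrite muln_gt0 expn_gt0 Q0.
by rewrite PS -[(_ ^+ _)%g]mul1g; apply: polynomial_seqM => //; exact: Epoly.
Qed.

Lemma common_exponent (I : finType) (X : I -> T) :
  exists2 M : nat, (0 < M)%N & forall i, torsion (X i) -> (X i ^+ M = 1)%g.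
Proof.
have /choice[e eP] : forall i, exists n : nat, (0 < n)%N /\
    (torsion (X i) -> (X i ^+ n = 1)%g).
  move=> i; have [[n n0 Xn]|?] := pselect (torsion (X i)); last by exists 1%N.
  by exists n.
exists (\prod_i e i)%N; first by apply: prodn_gt0 => i; case: (eP i).
move=> i tX; apply: expg_dvd ((eP i).2 tX).
by rewrite (bigD1 i) //= dvdn_mulr.
Qed.

Lemma calH_dense (phi : {ptws nat -> homT R}) (m : nat) (J : finType)
    (x : J -> T) (eps : R[i]) : calH phi -> 0 < eps ->
  exists2 n : nat, (0 < n)%N & forall k j, (k <= m)%N ->
    `|cval (x j ^+ 'C(n, k))%g - cval (phi k (x j))| < eps.
Proof.
move=> phiH eps0.
have [L LP] := @weyl_density R ('I_m.+1 * J)%type eps eps0.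
pose F := {ffun 'I_m.+1 * J -> 'I_L.+1}.
(* The monomial in the points x_j formed from the exponents at level k; negative exponents come from
   the conjugated factors of the character. *)
pose X (p : F * F) (k : nat) : T :=
  (\prod_j (x j ^+ p.1 (inord k, j) * (x j)^-1 ^+ p.2 (inord k, j)))%g.
(* M must serve all these monomials at once, because the progression is chosen from M and has to be
   fixed before the character (f, g) is given. *)
have [M M0 XM] := common_exponent (fun q : F * F * 'I_m.+1 => X q.1 q.2).
have [a [Q [a0 Q0 aP]]] := calH_power m M0 phiH.
pose u (i : 'I_m.+1 * J) n : T := (x i.2 ^+ 'C(a + Q * n, i.1) * (phi i.1 (x i.2))^-1)%g.
have [|n nP] := LP u; last first.
  exists (a + Q * n)%N => [|k j km]; first by rewrite addn_gt0 a0.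
  have := nP (inord k, j); rewrite /u [(_, _).1]/= [(_, _).2]/= inordK //.
  rewrite cvalM cvalV; set y := cval (x j ^+ _)%g; set z := phi k _ => yz.
  have -> : y - cval z = (y / cval z - 1) * cval z.
    by rewrite mulrBl divfK ?cval_neq0 // mul1r.
  by rewrite normrM norm_cval mulr1.
move=> f g chi.
have chiE : chi = fun l => cval (\prod_(k < m.+1)
    (X (f, g) k ^+ 'C(a + Q * l, k) * (phi k (X (f, g) k))^-1))%g.
  apply/funext => l; rewrite (big_morph _ (@cvalM R) (@cval1 R)) /chi.
  rewrite [LHS](eq_bigr (fun p : 'I_m.+1 * J => cval (u (p.1, p.2) l) ^+
    f (p.1, p.2) * (cval (u (p.1, p.2) l))^* ^+ g (p.1, p.2))); last by case.
  rewrite -(pair_bigA _ (fun k j => cval (u (k, j) l) ^+ f (k, j) *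
    (cval (u (k, j) l))^* ^+ g (k, j))) /=; apply: eq_bigr => k _.
  (* For fixed k and l this is a homomorphism in y, so the product over j moves inside and becomes
     its value at the monomial X k. *)
  pose v y : T := (y ^+ 'C(a + Q * l, k) * (phi k y)^-1)%g.
  have vM y z : v (y * z)%g = (v y * v z)%g.
    by rewrite /v circle_expMn gmulfM circle_invM circle_mulACA.
  have v1 : v 1%g = 1%g by rewrite /v expg1n homT1 invg1 mulg1.
  have vX y e : v (y ^+ e)%g = (v y ^+ e)%g.
    by elim: e => [|e IH]; rewrite ?v1 // !expgS vM IH.
  have vV y : v y^-1%g = (v y)^-1%g.
    by apply: (@mulgI _ (v y)); rewrite -vM !mulgV v1.
  transitivity (cval (v (X (f, g) k))); last by [].
  rewrite (big_morph v vM v1) (big_morph _ (@cvalM R) (@cval1 R)).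
  apply: eq_bigr => j _; rewrite inord_val vM !vX vV [RHS]cvalM ![in RHS]cvalX -cval_conj.
  by [].
have : (forall l, (\prod_(k < m.+1)
    (X (f, g) k ^+ 'C(a + Q * l, k) * (phi k (X (f, g) k))^-1))%g = 1%g) \/ mean0 chi.
  rewrite chiE; apply: mean0_binomial_chars => //; first by case: phiH.
  move=> k km tX l; apply: aP => //.
  by have := XM ((f, g), inord k); rewrite /= inordK //; apply.
by case=> h; [left => l; rewrite chiE h|right].
Qed.

End Density.

(** * Closures in the topology of pointwise convergence *)

Section Closure.
Variable R : realType.
Local Notation T := (circle R).
Local Notation X := {ptws nat -> homT R}.
Implicit Types (phi psi : X) (A : set X).

Lemma cvg_initialP (S : choiceType) (U : topologicalType) (f : S -> U)
    (F : set_system S) (s : S) : Filter F ->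
  F --> (s : initial_topology f) <-> f @ F --> f s.
Proof.
move=> FF; split=> [cvF|cvf B /= [_ [[C Cop <-] Cfs sCB]]].
  by apply: (@cvg_comp _ _ _ _ f); [exact: cvF|exact: initial_continuous].
by apply: (filterS sCB); apply: cvf; apply: open_nbhs_nbhs.
Qed.

Lemma cvg_ptwsP (I : Type) (V : topologicalType) (F : set_system {ptws I -> V})
    (f : {ptws I -> V}) : Filter F ->
  F --> f <-> forall t, (fun g : {ptws I -> V} => g t) @ F --> f t.
Proof.
move=> FF; split=> [/cvg_sup cvF t|cvF].
  by apply/cvg_initialP; exact: cvF.
by apply/cvg_sup => t; apply/cvg_initialP; exact: cvF.
Qed.

Lemma cvg_homTP (F : set_system (homT R)) (f : homT R) : Filter F ->
  F --> f <-> forall x : T,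
    (fun g : homT R => cval (g x) : R[i]^o) @ F --> (cval (f x) : R[i]^o).
Proof.
move=> FF; split=> [cvF x|cvF].
  have /cvg_initialP /cvg_ptwsP /(_ x) h := cvF.
  exact: (iffLR (@cvg_initialP _ _ (fun x : T => (x : R[i]^o)) _ _ _) h).
apply/cvg_initialP; apply/cvg_ptwsP => x; apply/cvg_initialP; exact: cvF.
Qed.

Lemma cvg_sequence_hom (F : set_system X) phi : Filter F ->
  F --> phi <-> forall k (x : T),
    (fun psi => cval (psi k x) : R[i]^o) @ F --> (cval (phi k x) : R[i]^o).
Proof.
move=> FF; rewrite cvg_ptwsP; split=> [Fphi k|Fphi k].
  exact: (iffLR (@cvg_homTP ((fun g : X => g k) @ F) (phi k) _) (Fphi k)).
exact: (iffRL (@cvg_homTP ((fun g : X => g k) @ F) (phi k) _) (Fphi k)).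
Qed.

(** Reduces the topology to finitely many values: a basic neighbourhood constrains finitely many
    coordinates k at finitely many points. *)
Lemma closureP A phi : closure A phi <->
  forall (m : nat) (J : finType) (x : J -> T) (eps : R[i]), 0 < eps ->
    exists2 psi, A psi & forall k j, (k <= m)%N ->
      `|cval (psi k (x j)) - cval (phi k (x j))| < eps.
Proof.
split=> [clA m J x eps eps0|approx].
  have phi_cvg : nbhs phi --> phi by [].
  have /(cvg_sequence_hom _) ev := phi_cvg.
  have near1 : nbhs phi [set psi : X | forall i : 'I_m.+1 * J,
      `|cval (psi i.1 (x i.2)) - cval (phi i.1 (x i.2))| < eps].
    apply: (@filter_forall _ _ _ _ (nbhs_filter phi)) => -[i j] /=.
    have /cvgrPdist_lt/(_ eps eps0) := ev i (x j).
    by apply: filterS => psi; rewrite distrC.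
  have [psi [Apsi psiP]] := clA _ near1.
  exists psi => // k j km.
  by have := psiP (Ordinal (km : (k < m.+1)%N), j).
pose D := (nat * seq T * nat)%type.
pose U (d : D) : set X := [set psi | A psi /\
  forall k x, (k <= d.1.1)%N -> x \in d.1.2 ->
    `|cval (psi k x) - cval (phi k x)| < d.2.+1%:R^-1].
(* The approximants taken from A generate a proper filter that contains A and converges to [phi], so
   every neighbourhood of [phi] meets A. *)
pose F := filter_from [set: D] U.
have FF : ProperFilter F.
  apply: filter_from_proper.
    apply: filter_from_filter; first by exists (0%N, [::], 0%N).
    move=> [[m s] q] [[m' s'] q'] _ _; exists (maxn m m', s ++ s', maxn q q') => //.
    move=> psi [Apsi /= psiP]; split; split=> // k x km xs; apply: lt_le_trans.
    - by apply: psiP; [rewrite leq_max km|rewrite mem_cat xs].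
    - by rewrite lef_pV2 ?posrE ?ltr0n // ler_nat ltnS leq_maxl.
    - by apply: psiP; [rewrite leq_max km orbT|rewrite mem_cat xs orbT].
    - by rewrite lef_pV2 ?posrE ?ltr0n // ler_nat ltnS leq_maxr.
  move=> [[m s] q] _.
  have q0 : 0 < q.+1%:R^-1 :> R[i] by rewrite invr_gt0 ltr0n.
  have [psi Apsi psiP] := approx m _ (fun j : 'I_(size s) => nth 1%g s j) _ q0.
  exists psi; split=> // k x km /= xs.
  have xi : (index x s < size s)%N by rewrite index_mem.
  by have := psiP k (Ordinal xi) km; rewrite /= nth_index.
have Fphi : F --> phi.
  apply/cvg_sequence_hom => k x; apply/cvgrPdist_lt => eps eps0.
  have [q qP] := complex_archi eps^-1.
  exists (k, [:: x], q) => // psi [_ /(_ k x (leqnn k))].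
  rewrite mem_head => /(_ isT) /=; rewrite distrC => /lt_trans; apply.
  rewrite -[ltRHS]invrK ltf_pV2 ?posrE ?invr_gt0 ?ltr0n //.
  apply: (@lt_trans _ _ q%:R); last by rewrite ltr_nat.
  by move: qP; rewrite gtr0_norm // invr_gt0.
move=> B /Fphi FB.
have FA : F A by exists (0%N, [::], 0%N) => // psi [].
exact: filter_ex (filterI FA FB).
Qed.

End Closure.

(** * The space of sequences as the orbit closure *)

Section OrbitClosure.
Variable R : realType.
Local Notation T := (circle R).
Local Notation X := {ptws nat -> homT R}.
Implicit Types (phi psi : X) (A : set X).

Lemma tilde_natE n k (x : T) : tilde R n%:Z k x = (x ^+ 'C(n, k))%g.
Proof.
elim: n k => [|n IH] [|k]; first by [].
- by rewrite bin0n.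
- by rewrite -[LHS]/(tilde R n%:Z 0%N x) IH !bin0.
- rewrite -[LHS]/(tilde R n%:Z k x * tilde R n%:Z k.+1 x)%g !IH.
  by rewrite binS addnC expgnDr.
Qed.

(** Where [phi] acts through C(n + 1, k), its preimage acts through C(n, k) by Pascal's rule; such
    an n exists because the progression of [calH_power] starts at a positive number. *)
Lemma Tshift_inv_calH phi : calH phi -> calH (Tshift_inv phi : X).
Proof.
move=> phiH; have phi0 := phiH.1; apply: power_calH => // M m M0.
have [[|n] [Q [// _ _ nP]]] := calH_power m M0 phiH.
exists n; elim=> [|k IH] x km xM; first by rewrite bin0 /= phi0.
have -> : (Tshift_inv phi k.+1 : homT R) x =
  ((Tshift_inv phi k x)^-1 * phi k.+1 x)%g by [].
rewrite IH ?(ltnW km) //.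
have := nP 0%N _ _ km xM; rewrite muln0 addn0 => ->.
by rewrite binS addnC expgnDr mulKg.
Qed.

Lemma tilde_calH (n : int) : calH (tilde R n).
Proof.
have tilde_nat k : calH (tilde R k%:Z).
  apply: power_calH.
    by apply: homT_ext => x; rewrite tilde_natE bin0.
  by move=> M m _; exists k => j x _ _; exact: tilde_natE.
case: n => [k|k]; first exact: tilde_nat.
elim: k => [|k IH]; first exact/Tshift_inv_calH/(tilde_nat 0%N).
exact: Tshift_inv_calH IH.
Qed.

(** If u = x / y is not 1, its first M powers sum to 0, so the numbers 1 - u^i sum to M; but each
    has modulus at most i |u - 1| < 1. *)
Lemma root_of_unity_dist M (x y : T) : (0 < M)%N ->
  (x ^+ M = 1)%g -> (y ^+ M = 1)%g ->
  `|cval x - cval y| < M%:R^-1 -> x = y.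
Proof.
move=> M0 xM yM xy; pose u := (x * y^-1)%g.
have uM : cval u ^+ M = 1.
  by rewrite -cvalX circle_expMn expVgn xM yM invg1 mulg1.
have u1 : `|cval u - 1| < M%:R^-1.
  rewrite (_ : cval u - 1 = (cval x - cval y) / cval y); last first.
    by rewrite mulrBl divff ?cval_neq0.
  by rewrite normrM normfV norm_cval invr1 mulr1.
have [/eqP|un1] := eqVneq (cval u) 1.
  by rewrite -cval1 => /eqP/val_inj/divg1_eq.
have su : \sum_(i < M) cval u ^+ i = 0.
  apply/eqP; rewrite -(mulrI_eq0 _ (mulfI (_ : cval u - 1 != 0))) ?subr_eq0 //.
  by rewrite -subrX1 uM subrr.
have ple i : `|1 - cval u ^+ i| <= i%:R * `|cval u - 1|.
  rewrite distrC subrX1 normrM mulrC ler_wpM2r //.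
  apply: le_trans (ler_norm_sum _ _ _) _.
  rewrite (eq_bigr (fun=> 1)); first by rewrite sumr_const card_ord.
  by move=> j _; rewrite normrX norm_cval expr1n.
have : M%:R <= \sum_(i < M) `|1 - cval u ^+ i|.
  have := ler_norm_sum (index_enum 'I_M) (fun i : 'I_M => 1 - cval u ^+ i) xpredT.
  by rewrite sumrB su subr0 sumr_const card_ord normr_nat.
have : \sum_(i < M) `|1 - cval u ^+ i| < M%:R.
  rewrite -[X in _ < X%:R]card_ord -sumr_const.
  apply: ltr_sum; first by case: (M) M0 => // ? _; rewrite /index_enum -enumT enum_ordSl.
  move=> i _; apply: le_lt_trans (ple i) _.
  apply: (@le_lt_trans _ _ (M%:R * `|cval u - 1|)).
    by rewrite ler_wpM2r // ler_nat ltnW.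
  by rewrite mulrC -ltr_pdivlMr ?ltr0n // mul1r.
by move=> /lt_le_trans h /h; rewrite ltxx.
Qed.

(** A member of A that is closer than 1 / M at a primitive M-th root of unity agrees with [phi]
    there, hence at all M-th roots, so [power_calH] applies to [phi]. *)
Lemma closure_calH A : A `<=` @calH R -> closure A `<=` @calH R.
Proof.
move=> AH phi /closureP clA; apply: power_calH.
  (* If phi_0 moved x, the distance moved would be a tolerance that no member of A meets. *)
  apply: homT_ext => x /=; apply: contrapT => /eqP.
  rewrite -(inj_eq val_inj) -subr_eq0 -normr_gt0 => eps0.
  have [psi /AH[psi0 _] /(_ 0%N tt (leqnn _))] := clA 0%N _ (fun _ : unit => x) _ eps0.
  by rewrite psi0 distrC ltxx.
move=> M m M0; pose z : T := expi (2 * pi / M%:R).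
have zM : (z ^+ M = 1)%g.
  by apply: val_inj; rewrite [LHS]cvalX (prim_expr_order (expi_primitive R M0)).
have eps0 : 0 < M%:R^-1 :> R[i] by rewrite invr_gt0 ltr0n.
have [psi /AH psiH psiP] := clA m _ (fun _ : unit => z) _ eps0.
have [n [Q [_ _ nP]]] := calH_power m M0 psiH; exists n => k x km xM.
have := nP 0%N _ _ km zM; rewrite muln0 addn0 => psiz.
have [i ->] := root_of_unityP M0 xM.
rewrite homTX expgnAC; congr (_ ^+ _)%g; rewrite -psiz; symmetry.
apply: (root_of_unity_dist M0); last exact: psiP k tt km.
  by rewrite -homTX zM homT1.
by rewrite -homTX zM homT1.
Qed.

Lemma calH_closure_nat :
  @calH R = closure [set tilde R n%:Z | n in [set n : nat | (0 < n)%N]].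
Proof.
apply/seteqP; split=> [phi phiH|]; last first.
  by apply: closure_calH => _ [n _ <-]; exact: tilde_calH.
apply/closureP => m J x eps eps0.
have [n n0 nP] := calH_dense m x phiH eps0.
exists (tilde R n%:Z); first by exists n.
by move=> k j km; rewrite tilde_natE; exact: nP.
Qed.

Lemma calH_orbit_closure :
  @calH R = orbit_closure (@Tshift R) (@Tshift_inv R) (tilde0 R).
Proof.
apply/seteqP; split; last by apply: closure_calH => _ [n _ <-]; exact: tilde_calH.
rewrite calH_closure_nat; apply: closureS => _ [n _ <-].
by exists n%:Z.
Qed.

End OrbitClosure.

(** * Extension of homomorphisms into the divisible group of the circle *)

Section HomExtension.
Variable R : realType.
Local Notation T := (circle R).
Implicit Types (G : set (T * T)) (x y : T).

(* [G] is the graph of a homomorphism from a subgroup of the circle. *)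
Definition partial_hom G := [/\ G (1%g, 1%g),
  forall x y x' y', G (x, y) -> G (x', y') -> G (x * x'^-1, y * y'^-1)%g
  & forall y, G (1%g, y) -> y = 1%g].

Definition adjoin G x r : set (T * T) := [set p | exists n a b,
  G (a, b) /\ p = (expgz x n * a, expgz r n * b)%g].

Lemma partial_homM G x y x' y' : partial_hom G ->
  G (x, y) -> G (x', y') -> G (x * x', y * y')%g.
Proof.
move=> [G1 GV _] Gxy /(GV _ _ _ _ G1); rewrite !mul1g => /(GV _ _ _ _ Gxy).
by rewrite !invgK.
Qed.

Lemma partial_homX G x y (n : int) : partial_hom G ->
  G (x, y) -> G (expgz x n, expgz y n).
Proof.
move=> hG Gxy; have [G1 GV _] := hG.
have GX k : G (x ^+ k, y ^+ k)%g.
  by elim: k => [|k IH]; rewrite ?expg0 // !expgS; exact: partial_homM.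
case: n => k /=; first exact: GX.
by have := GV _ _ _ _ G1 (GX k.+1); rewrite !mul1g.
Qed.

Lemma partial_hom_inj G x y y' : partial_hom G -> G (x, y) -> G (x, y') -> y = y'.
Proof.
move=> [_ GV G1] Gy Gy'; apply: divg1_eq; apply: G1.
by have := GV _ _ _ _ Gy Gy'; rewrite mulgV.
Qed.

(** The second hypothesis says that r is compatible with the values already prescribed on powers of
    x, which is what keeps the enlarged graph single-valued. *)
Lemma adjoin_partial_hom G x r : partial_hom G ->
  (forall n y, G (expgz x n, y) -> y = expgz r n) ->
  [/\ partial_hom (adjoin G x r), G `<=` adjoin G x r & adjoin G x r (x, r)].
Proof.
move=> [G1 GV Ginj] xr; split.
- split.
  + by exists 0, 1%g, 1%g; rewrite /= !mul1g.
  + move=> _ _ _ _ [n [a [b [Gab [-> ->]]]]] [n' [a' [b' [Gab' [-> ->]]]]].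
    exists (n - n'), (a * a'^-1)%g, (b * b'^-1)%g; split; first exact: GV.
    by rewrite !expgzD !expgzN !circle_invM (circle_mulACA (expgz x n))
      (circle_mulACA (expgz r n)).
  + move=> _ [n [a [b [Gab [/esym/eqP xa ->]]]]].
    have ax : a = expgz x (- n).
      rewrite expgzN; apply: (@mulgI _ (expgz x n)); rewrite mulgV; exact/eqP.
    rewrite ax in Gab; rewrite (xr _ _ Gab).
    by rewrite -expgzD subrr.
- by move=> [a b] Gab; exists 0, a, b; rewrite /= !mul1g.
- by exists 1, 1%g, 1%g; rewrite /= !mulg1.
Qed.

(** The exponents n with x^n in the domain are the multiples of some d. If d > 0, divisibility gives
    a d-th root r of the value at x^d; otherwise any r will do and 1 is taken. *)
Lemma partial_hom_value G x : partial_hom G ->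
  exists r : T, forall n y, G (expgz x n, y) -> y = expgz r n.
Proof.
move=> hG; have [G1 GV Ginj] := hG.
have [exn|noG] := pselect (exists n, (0 < n)%N && `[< exists y, G (x ^+ n, y)%g >]).
  have [d /andP[d0 /asboolP[y Gy]] dmin] := ex_minnP exn.
  have [r rd] := circle_root y d0.
  exists r => n z Gz.
  have := divz_eq n d; set q := (n %/ d)%Z; set s := (n %% d)%Z => nE.
  have s0 : 0 <= s by rewrite modz_ge0 // -lt0n.
  have sd : s < d%:Z by rewrite ltz_mod // -lt0n.
  (* The remainder s of n modulo d is again such an exponent, so minimality of d forces s = 0. *)
  have Gs : G (expgz x s, z * (expgz y q)^-1)%g.
    have := GV _ _ _ _ Gz (partial_homX q hG Gy).
    rewrite (_ : expgz x s = expgz x n * (expgz (x ^+ d) q)^-1)%g //.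
    rewrite -[(x ^+ d)%g]/(expgz x d) -expgzM -expgzN -expgzD nE; congr expgz.
    by ring.
  have {Gs}s00 : s = 0.
    case: s s0 sd Gs {nE} => // -[//|s] _ sd Gs.
    have : (d <= s.+1)%N by apply: dmin; apply/asboolP; eexists; exact: Gs.
    by rewrite leqNgt => /negP[].
  rewrite nE s00 addr0 mulrC expgzM -[expgz r d]/(r ^+ d)%g rd.
  apply: (partial_hom_inj hG Gz); rewrite nE s00 addr0 mulrC expgzM.
  exact: partial_homX.
exists 1%g => n y.
have noG' k z : ~ G (x ^+ k.+1, z)%g.
  by move=> Gz; apply: noG; exists k.+1; apply/asboolP; exists z.
have one k : expgz (1%g : T) k = 1%g by case: k => k /=; rewrite expg1n ?invg1.
rewrite one; case: n => [[|k]|k] /=; first exact: Ginj.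
  by move/noG'.
by move=> /(GV _ _ _ _ G1); rewrite mul1g invgK => /noG'.
Qed.

Lemma partial_hom_extend G : partial_hom G ->
  exists f : homT R, forall x y, G (x, y) -> f x = y.
Proof.
move=> hG; have [G1 GV Ginj] := hG.
(* Taking the union with G makes the condition hold for the empty chain too, whose union is the
   empty set. *)
have [|A [hA Amax]] := @Zorn_bigcup _ (fun A => partial_hom (A `|` G)).
  move=> F FP Ftot; split.
  - by right.
  - have step A p q : F A -> (A `|` G) p -> (A `|` G) q ->
        (\bigcup_(X in F) X `|` G) (p.1 * q.1^-1, p.2 * q.2^-1)%g.
      move=> FA; have [_ AV _] := FP _ FA; case: p q => [a b] [a' b'] Ap Aq.
      by have [?|?] := AV _ _ _ _ Ap Aq; [left; exists A|right].
    move=> x y x' y' [[A FA Axy]|Gxy] [[B FB Bxy]|Gxy'].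
    + have [AB|BA] := Ftot _ _ FA FB.
        by apply: (step B (x, y) (x', y')) => //; left => //; exact: AB.
      by apply: (step A (x, y) (x', y')) => //; left => //; exact: BA.
    + by apply: (step A (x, y) (x', y')) => //; [left|right].
    + by apply: (step B (x, y) (x', y')) => //; [right|left].
    + by right; exact: GV.
  - move=> y [[A FA Ay]|/Ginj//]; have [_ _] := FP _ FA; apply; by left.
have tot x : exists y, (A `|` G) (x, y).
  have [r xr] := partial_hom_value x hA.
  have [hadj AGadj adjx] := adjoin_partial_hom hA xr.
  apply: contrapT => /forallNP nox.
  apply: (Amax (adjoin (A `|` G) x r)).
    split; first by move=> p Ap; apply: AGadj; left.
    by move=> /(_ _ adjx) Ax; apply: (nox r); left.
  suff -> : adjoin (A `|` G) x r `|` G = adjoin (A `|` G) x r by [].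
  by apply/setUidPl => p Gp; apply: AGadj; right.
have [f fP] := choice tot.
have fM : {morph f : x y / (x * y)%g}.
  move=> x y; apply: (partial_hom_inj hA (fP _)).
  exact: partial_homM hA (fP x) (fP y).
exists (homT_of fM) => x y Gxy /=.
by apply: (partial_hom_inj hA (fP x)); right.
Qed.

(** * The Stirling relation as a prescription on torsion points, and its solutions *)

Definition stirling_prod (f : homT R) k x : T :=
  (\prod_(1 <= j < k.+1) iter j f (expgz x (stirling1 k j)))%g.

(** Both points lie among the roots of unity of one order, where f is a power map and the Stirling
    product is one as well. *)
Lemma stirling_prod_div f k x y : (0 < k)%N -> torsion x -> torsion y ->
  stirling_prod f k (x * y^-1)%g =
    (stirling_prod f k x * (stirling_prod f k y)^-1)%g.
Proof.
move=> k0 [M M0 xM] [N N0 yN].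
have MN : (0 < M * N)%N by rewrite muln_gt0 M0.
have [n nP] := hom_power_on_roots f MN.
have xMN : (x ^+ (M * N) = 1)%g by rewrite expgnA xM expg1n.
have yMN : (y ^+ (M * N) = 1)%g by rewrite mulnC expgnA yN expg1n.
have fn z : (z ^+ (M * N) = 1)%g -> f z = (z ^+ n)%g.
  by move=> /(nP 0%N); rewrite muln0 addn0.
rewrite /stirling_prod !(prod_stirling1 k0 fn) //.
  by rewrite circle_expMn expVgn.
by rewrite circle_expMn expVgn xMN yMN mulgV.
Qed.

(** The exponent of the Stirling product, a falling factorial, is divisible by k!. Thus the value
    prescribed at x^(k!) does not depend on the choice of x. *)
Lemma stirling_prod1 f k x : (0 < k)%N -> (x ^+ k`! = 1)%g ->
  stirling_prod f k x = 1%g.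
Proof.
move=> k0 xk; have [n nP] := hom_power_on_roots f (fact_gt0 k).
have fn z : (z ^+ k`! = 1)%g -> f z = (z ^+ n)%g.
  by move=> /(nP 0%N); rewrite muln0 addn0.
by rewrite /stirling_prod (prod_stirling1 k0 fn) // -bin_ffact mulnC expgnA xk expg1n.
Qed.

Definition stirling_graph (f : homT R) k : set (T * T) :=
  [set (x ^+ k`!, stirling_prod f k x)%g | x in @torsion R].

Lemma stirling_graph_hom f k : (0 < k)%N -> partial_hom (stirling_graph f k).
Proof.
move=> k0; split.
- exists 1%g; first exact: torsion1.
  by rewrite expg1n stirling_prod1 // expg1n.
- move=> _ _ _ _ [x tx [<- <-]] [y ty [<- <-]]; exists (x * y^-1)%g.
    exact/torsionM/torsionV.
  by rewrite stirling_prod_div // circle_expMn expVgn.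
- by move=> _ [x tx [xk <-]]; exact: stirling_prod1.
Qed.

Lemma stirling_rel_exists f k : (0 < k)%N -> exists g : homT R, stirling_rel f k g.
Proof.
move=> k0; have [g gP] := partial_hom_extend (stirling_graph_hom f k0).
by exists g => x /TQP tx; apply: gP; exists x.
Qed.

(** The prescription lives on torsion points, and no power of x0 with nonzero exponent is torsion.
    Only n = 0 has to be checked for compatibility, so any z may be adjoined as the value at x0. *)
Lemma stirling_rel_exists_at f k x0 z : (0 < k)%N -> ~ TQ x0 ->
  exists2 g : homT R, stirling_rel f k g & g x0 = z.
Proof.
move=> k0 x0Q; have hG := stirling_graph_hom f k0.
have x0z n y : stirling_graph f k (expgz x0 n, y) -> y = expgz z n.
  move=> Gy; have [t tt [tx _]] := Gy.
  have [m m0 xm] : torsion (expgz x0 n) by rewrite -tx; exact: torsionX.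
  have tors e : (0 < e)%N -> (x0 ^+ e = 1)%g -> False.
    by move=> e0 xe; apply/x0Q/TQP; exists e.
  case: n xm Gy {tx} => [[|n]|n] /=.
  - by move=> _; case: hG => _ _; apply.
  - by rewrite -expgnA => /tors; rewrite muln_gt0 m0 => /(_ isT).
  - rewrite expVgn -expgnA => /eqP; rewrite invg_eq1 => /eqP/tors.
    by rewrite muln_gt0 m0 => /(_ isT).
have [hadj Gadj adjx] := adjoin_partial_hom hG x0z.
have [g gP] := partial_hom_extend hadj.
exists g; last exact: gP.
by move=> x /TQP tx; apply/gP/Gadj; exists x.
Qed.

Lemma rho_surj m : (0 < m)%N -> set_surj (@calH R) (@calHm R m) (@rho R m).
Proof.
move=> m0 phi [phi0 phiP].
(* Each relation involves only phi_1 and phi_k, so the missing coordinates can be chosen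
   independently; m > 0 ensures that phi_1 is already given. *)
have /choice[psi psiP] : forall k, exists g : homT R,
    ((k <= m)%N -> g = phi (inord k)) /\
    ((m < k)%N -> stirling_rel (phi (inord 1)) k g).
  move=> k; have [km|mk] := leqP k m; first by exists (phi (inord k)).
  have [g gP] := stirling_rel_exists (phi (inord 1)) (leq_ltn_trans (leq0n m) mk).
  by exists g.
have psiE k : (k <= m)%N -> psi k = phi (inord k) by case: (psiP k).
exists psi; last first.
  by apply/funext => k; rewrite /rho psiE ?inord_val // -ltnS.
split=> [|k k0].
  by rewrite psiE // -phi0; congr phi; apply/val_inj; rewrite /= inordK.
rewrite (psiE 1%N m0); have [km|mk] := leqP k m; last by case: (psiP k) => _; apply.
by rewrite psiE //; have := phiP (inord k); rewrite inordK //; apply.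
Qed.

Lemma calHm_extend m (phi : {ptws 'I_m.+1 -> homT R}) (psi : homT R) : (0 < m)%N ->
  calHm phi -> stirling_rel (phi (inord 1)) m.+1 psi -> calHm (extend phi psi).
Proof.
move=> m0 [phi0 phiP] psiP.
have ext_lift j : extend phi psi (lift ord_max j) = phi j by rewrite /extend liftK.
have ext_max : extend phi psi ord_max = psi by rewrite /extend unlift_none.
have e1 : inord 1 = lift ord_max (inord 1 : 'I_m.+1) :> 'I_m.+2.
  by apply: val_inj; rewrite /= !inordK ?ltnS // /bump leqNgt ltnS m0.
split.
  rewrite (_ : ord0 = lift ord_max (ord0 : 'I_m.+1)) ?ext_lift //.
  exact: val_inj.
move=> k k0; rewrite e1 ext_lift.
have [j kj|->] := unliftP ord_max k; last by rewrite ext_max.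
rewrite kj ext_lift in k0 *.
have vj : lift ord_max j = j :> nat by rewrite /= /bump leqNgt ltn_ord.
by rewrite vj in k0 *; exact: phiP.
Qed.

End HomExtension.

Theorem lemma3p5 (R : realType) :
  [/\ (@calH R = orbit_closure (@Tshift R) (@Tshift_inv R) (tilde0 R) /\
       @calH R = closure [set tilde R n%:Z | n in [set n : nat | (0 < n)%N]]),
      (forall m : nat, (0 < m)%N ->
         set_surj (@calH R) (@calHm R m) (@rho R m))
    & (forall (m : nat) (phi : {ptws 'I_m.+1 -> homT R}) (x0 : circle R),
         (0 < m)%N -> calHm phi -> ~ TQ x0 ->
         [set (psi : homT R) x0 | psi in
            [set psi : homT R | calHm (extend phi psi)]] = [set: circle R])].
Proof.
split.
- by split; [exact: calH_orbit_closure|exact: calH_closure_nat].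
- exact: rho_surj.
- move=> m phi x0 m0 phiH x0Q; apply/seteqP; split=> // z _.
  have [g gP gx0] := stirling_rel_exists_at (phi (inord 1)) z (ltn0Sn m) x0Q.
  by exists g => //; exact: calHm_extend.
Qed.
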